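(* Let $\gamma\ge 2$ be an integer. There exists a number $\Delta_0$ (depending only on $\gamma$) such that for every connected graph $G$ with maximum degree $\Delta\ge 3$, writing $M=\Delta\frac{(\Delta-1)^{\gamma}-1}{\Delta-2}$: if $\Delta$ is odd and $\Delta\ge\Delta_0$, then $\chi_\gamma(G)\le M-1$ unless $G$ is a Moore graph. In fact, $\Delta_0=(10^{14}+1)^{1/\gamma}+1$ has this property.
   Context: Graphs are finite and simple. The $\gamma$-th power $G^\gamma$ of $G$ is the graph on the vertex set of $G$ in which two distinct vertices are adjacent if and only if their distance in $G$ is at most $\gamma$. $\chi_\gamma(G):=\chi(G^\gamma)$ is the chromatic number of $G^\gamma$. Here ''Moore graph'' means a Moore graph with degree $\Delta$ and diameter $\gamma$: a $\Delta$-regular graph of order $M+1$ with girth $2\gamma+1$ and diameter $\gamma$. *)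

(* Defs.v *)
From mathcomp Require Import all_boot all_order all_algebra.
From mathcomp Require Import reals exp.
Import Order.TTheory GRing.Theory Num.Theory.

Set Implicit Arguments.
Unset Strict Implicit.
Unset Printing Implicit Defensive.

Record sgraph := SGraph {
  vertex :> finType;
  adj : rel vertex;
  adj_sym : symmetric adj;
  adj_irrefl : irreflexive adj }.

Definition degree (G : sgraph) (x : G) : nat := #|[set y | adj x y]|.

Definition max_degree (G : sgraph) : nat := \max_(x : G) degree x.

Definition regular (G : sgraph) (d : nat) : Prop := forall x : G, degree x = d.

Definition is_connected (G : sgraph) : Prop :=
  0 < #|G| /\ forall x y : G, connect (@adj G) x y.

Definition walk_of_length (G : sgraph) (x y : G) (k : nat) : bool :=
  [exists p : k.-tuple G, path (@adj G) x p && (last x p == y)].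

(* If x and y lie in different components, where the distance is infinite, the
   value is the junk #|G|; every finite distance is smaller than #|G|. *)
Definition dist (G : sgraph) (x y : G) : nat :=
  find (walk_of_length x y) (iota 0 #|G|).

Lemma dist_leP (G : sgraph) (x y : G) (k : nat) : connect (@adj G) x y ->
  reflect (exists p, [/\ path (@adj G) x p, last x p = y & size p <= k])
          (dist x y <= k).
Proof.
move=> cxy.
have wP j : reflect (exists p, [/\ path (@adj G) x p, last x p = y & size p = j])
                    (walk_of_length x y j).
  apply: (iffP existsP) => [[p /andP[pp /eqP lp]]|[p [pp lp /eqP sp]]].
    by exists p; rewrite size_tuple.
  by exists (Tuple sp); rewrite /= pp lp eqxx.
have small p : path (@adj G) x p -> last x p = y ->
    exists2 j, walk_of_length x y j & j < #|G| /\ j <= size p.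
  move=> pp; case: (shortenP pp) => q qp uq sq lq.
  exists (size q); first by apply/wP; exists q.
  split; last exact: uniq_leq_size (andP uq).2 sq.
  by rewrite -[(size q).+1]/(size (x :: q)) -(card_uniqP uq) max_card.
have hasw : has (walk_of_length x y) (iota 0 #|G|).
  have [p pp lp] := connectP cxy.
  have [//|j wj [jn _]] := small p pp.
  by apply/hasP; exists j; rewrite ?mem_iota.
apply: (iffP idP) => [dk|[p [pp lp sp]]].
  have := nth_find 0 hasw; rewrite nth_iota -?has_find ?add0n; last first.
    by move: hasw; rewrite has_find size_iota.
  by case/wP=> p [pp lp sp]; exists p; rewrite sp.
have [//|j wj [jn jp]] := small p pp.
apply: leq_trans (leq_trans jp sp); rewrite leqNgt; apply/negP => jd.
by have := before_find 0 jd; rewrite nth_iota // add0n wj.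
Qed.

Definition power_adj (G : sgraph) (g : nat) : rel G :=
  fun x y => [&& x != y, connect (@adj G) x y & dist x y <= g].
Arguments power_adj : clear implicits.

Lemma power_adj_sym (G : sgraph) (g : nat) : symmetric (power_adj G g).
Proof.
have sub (x y : G) : power_adj G g x y -> power_adj G g y x.
  case/and3P=> nxy cxy dxy; have symc := sym_connect_sym (@adj_sym G).
  have cyx : connect (@adj G) y x by rewrite symc.
  rewrite /power_adj eq_sym nxy cyx /=; apply/dist_leP => //.
  have [p [pp lp sp]] := dist_leP g cxy dxy.
  exists (rev (belast x p)); split; last by rewrite size_rev size_belast.
    by rewrite -lp rev_path; under eq_path do rewrite adj_sym.
  by case: p lp {pp sp} => [|z p] /= lp; rewrite ?lp // rev_cons last_rcons.
by move=> x y; apply/idP/idP; apply: sub.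
Qed.

Lemma power_adj_irrefl (G : sgraph) (g : nat) : irreflexive (power_adj G g).
Proof. by move=> x; rewrite /power_adj eqxx. Qed.

Definition power (G : sgraph) (g : nat) : sgraph :=
  SGraph (@power_adj_sym G g) (@power_adj_irrefl G g).

Definition colorable (G : sgraph) (k : nat) : bool :=
  [exists f : {ffun G -> 'I_k}, forall x, forall y, adj x y ==> (f x != f y)].

Lemma colorable_ex (G : sgraph) : exists k, colorable G k.
Proof.
exists #|G|; apply/existsP; exists [ffun x => enum_rank x].
apply/forallP=> x; apply/forallP=> y; apply/implyP; rewrite !ffunE.
by apply: contraL => /eqP/enum_rank_inj->; rewrite adj_irrefl.
Qed.

Definition chromatic_number (G : sgraph) : nat := ex_minn (colorable_ex G).

Definition power_chromatic_number (g : nat) (G : sgraph) : nat :=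
  chromatic_number (power G g).

(* The infinite diameter of a disconnected graph is not represented. *)
Definition diameter (G : sgraph) : nat := \max_(x : G) \max_(y : G) dist x y.

Definition is_cycle (G : sgraph) (c : seq G) : bool :=
  (2 < size c) && ucycleb (@adj G) c.

(* A relation, because forests have no (finite) girth. *)
Definition has_girth (G : sgraph) (g : nat) : Prop :=
  (exists2 c : seq G, is_cycle c & size c = g) /\
  (forall c : seq G, is_cycle c -> g <= size c).

(* For D >= 3 all subtractions and the division are exact, see
   moore_bound_exact. *)
Definition moore_bound (D g : nat) : nat :=
  (D * ((D - 1) ^ g - 1)) %/ (D - 2).

Lemma moore_bound_exact (F : numFieldType) (D g : nat) : 2 < D ->
  ((moore_bound D g)%:R =
    D%:R * ((D%:R - 1) ^+ g - 1) / (D%:R - 2) :> F)%R.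
Proof.
move=> D3; have D2 : 0 < D - 2 by rewrite subn_gt0.
have E : (D - 1) ^ g - 1 = (D - 2) * \sum_(i < g) (D - 1) ^ i.
  by rewrite !subn1 predn_exp subn2.
have -> : (D%:R - 2 : F)%R = (D - 2)%:R%R by rewrite natrB // ltnW.
have -> : ((D%:R - 1) ^+ g - 1 : F)%R = ((D - 1) ^ g - 1)%:R%R.
  rewrite natrB ?natrX ?natrB //; first by rewrite (leq_trans _ D3).
  by rewrite expn_gt0 subn_gt0 (ltn_trans _ D3).
rewrite -natrM /moore_bound E mulnCA mulKn // [in RHS]natrM mulrAC divff ?mul1r //.
by rewrite pnatr_eq0 -lt0n.
Qed.

Definition is_moore_graph (G : sgraph) (D g : nat) : Prop :=
  [/\ is_connected G, regular G D, #|G| = (moore_bound D g).+1,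
      has_girth G (2 * g).+1 & diameter G = g].

(* Main.v *)
Require Import Defs.
From mathcomp Require Import all_boot all_order all_algebra.
From mathcomp Require Import reals exp.
From mathcomp Require Import zify.

(** Write H for the g-th power of G, M for the Moore bound and n = M - 1 for the
    number of colours. There are M nonempty nonbacktracking walks of length at
    most g from a vertex of a D-regular graph, so every degree in H is at most
    M = n + 1.

    The colouring is greedy. A small set S is precoloured, two adjacent vertices
    w and v of G are kept for the end, in this order, and each of the other
    vertices is coloured while two of its neighbours in H are uncoloured. This
    works as soon as w has one saving and v has two ([finish_colouring]), where a
    saving is a neighbour missing in H or a coincidence of colours in S. If
    G is not regular, or if some vertex misses two neighbours in H, then S can be
    empty ([colourable_low]): a vertex which misses a neighbour is the start of
    two walks with the same end, and then so is one of its neighbours in G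
    ([ambiguous_nbr]). So G may be supposed regular, with all degrees in H equal
    to M or M - 1.

    If all distances are at most g, then G has order M, which is impossible
    because M and D are odd, or it has order M + 1 and is a Moore graph
    ([unambiguous_is_moore]). So some distance is larger than g, and pairs of
    vertices at such a distance may receive the same colour.

    For g >= 3 the distance to v is always a suitable order ([finish_pow3]), and
    it remains to find the pairs. If v is ambiguous one pair in its ball is
    enough, and there is one because a ball that is a clique of order M is the
    whole graph ([clique_ball_setT]), against parity. If no vertex is ambiguous,
    the ends of two overlapping geodesics of length g + 1 are two pairs
    ([colourable_unambiguous_ge3]).

    For g = 2 the order requires that G - S be connected, and here D is large. If
    H has no clique of almost M vertices, every ball contains many pairs. They are
    used to enlarge a connected set with at most 4 boundary vertices step by
    step until G - S is connected ([colourable_spread]). If H has such a clique,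
    then G is the clique with few additional vertices, and pairs can be
    chosen directly ([colourable_small_order]), or few edges leave the
    neighbourhood of the clique; then the two sides are coloured separately and
    the colours of one side are shifted ([colourable_near_clique]). *)

Set Implicit Arguments.
Unset Strict Implicit.
Unset Printing Implicit Defensive.
Local Open Scope nat_scope.

(** * Greedy colouring *)

Section Colouring.
Variables (T : finType) (e : rel T) (n : nat).
Hypotheses (e_sym : symmetric e) (e_irr : irreflexive e).
Implicit Types (X Y S : {set T}) (c : T -> 'I_n) (rk : T -> nat).

Definition nbh x := [set y | e x y].

Definition proper_on Y c := {in Y &, forall x y, e x y -> c x != c y}.

Lemma proper_extend1 Y c u : u \notin Y -> proper_on Y c ->
  #|c @: (nbh u :&: Y)| < n ->
  exists2 c', proper_on (u |: Y) c' & {in Y, c' =1 c}.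
Proof.
move=> uY pc ltn.
have /existsP[k kP] : [exists k : 'I_n, k \notin c @: (nbh u :&: Y)].
  rewrite -negb_forall; apply/negP => /forallP all_in.
  suff : n <= #|c @: (nbh u :&: Y)| by rewrite leqNgt ltn.
  rewrite -[leqLHS]card_ord; apply/subset_leq_card/subsetP => k _.
  exact: all_in.
pose c' x := if x == u then k else c x.
have c'E x : x \in Y -> c' x = c x.
  by rewrite /c' => xY; case: eqP => // xu; rewrite -xu xY in uY.
have c'u : c' u = k by rewrite /c' eqxx.
have new y : y \in Y -> e u y -> k != c y.
  move=> yY euy; apply: contraNneq kP => ->.
  by apply: imset_f; rewrite !inE euy.
exists c' => // x y /setU1P[->|xY] /setU1P[->|yY].
- by rewrite e_irr.
- by rewrite c'u c'E //; apply: new.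
- by rewrite e_sym c'u c'E // eq_sym; apply: new.
- by rewrite !c'E //; apply: pc.
Qed.

Lemma greedy_colouring X Y rk c : [disjoint X & Y] -> proper_on Y c ->
  {in X, forall u, #|[set t in nbh u |
     (t \in Y) || ((t \in X) && (rk u <= rk t))]| < n} ->
  exists2 c', proper_on (X :|: Y) c' & {in Y, c' =1 c}.
Proof.
move=> + pc; move: {2}#|X| (leqnn #|X|) => m.
elim: m X => [|m IH] X.
  rewrite leqn0 cards_eq0 => /eqP-> _ _; exists c => //.
  by rewrite set0U.
move=> leX disX few.
have [X0|[u0 u0X]] := set_0Vmem X.
  by rewrite X0; exists c => //; rewrite set0U.
have [u uX' umin] := @arg_minnP _ u0 (mem X) rk u0X.
have uX : u \in X by exact: uX'.
have uY : u \notin Y.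
  by apply/negP => uY; move/pred0P: disX => /(_ u) /=; rewrite uX uY.
have [| | |c1 pc1 c1E] := IH (X :\ u).
- by rewrite -ltnS; apply: leq_trans leX; rewrite [in ltnRHS](cardsD1 u) uX.
- by apply: disjointWl disX; apply: subD1set.
- move=> x /setD1P[_ xX]; apply: leq_ltn_trans (few x xX).
  apply/subset_leq_card/subsetP => t; rewrite !inE => /andP[-> /=].
  by case: (t \in Y) => //= /andP[/andP[_ ->]].
have [| |c2 pc2 c2E] := @proper_extend1 (X :\ u :|: Y) c1 u _ pc1.
- by rewrite !inE eqxx.
- apply: leq_ltn_trans (leq_imset_card _ _) _; apply: leq_ltn_trans (few u uX).
  apply/subset_leq_card/subsetP => t; rewrite !inE => /andP[-> /=].
  by case: (t \in Y); rewrite ?orbT //= orbF => /andP[_ tX]; rewrite tX umin.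
exists c2; last by move=> x xY; rewrite c2E ?c1E // inE xY orbT.
by rewrite -(setD1K uX) -setUA.
Qed.

Hypothesis deg_le : forall u, #|nbh u| <= n.+1.

(** The form of the greedy argument that is used throughout: the degree is at
    most one more than the number of colours, so that two neighbours which are
    still uncoloured when u is reached leave a free colour for u. *)
Lemma greedy_colouring2 X Y rk c : [disjoint X & Y] -> proper_on Y c ->
  {in X, forall u, exists t1 t2, [/\ t1 != t2, e u t1, e u t2 &
     {in [:: t1; t2], forall t, t \notin Y /\ (t \in X -> rk t < rk u)}]} ->
  exists2 c', proper_on (X :|: Y) c' & {in Y, c' =1 c}.
Proof.
move=> disX pc late; apply: (greedy_colouring (rk := rk)) => // u uX.
have [t1 [t2 [t12 e1 e2 lt]]] := late u uX.
set A := [set _ in _ | _].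
have notA t : t \in [:: t1; t2] -> t \notin A.
  move=> tt; have [tY trk] := lt t tt; rewrite inE (negbTE tY) /=.
  apply/negP => /andP[_ /andP[tX]]; by rewrite leqNgt trk.
have /subset_leq_card : A \subset nbh u :\ t1 :\ t2.
  apply/subsetP => t tA; rewrite !inE.
  have -> : e u t by move: tA; rewrite !inE => /andP[].
  rewrite andbT; apply/andP; split; apply: contraTneq tA => ->;
  by apply: notA; rewrite !inE eqxx ?orbT.
have := cardsD1 t1 (nbh u); have := cardsD1 t2 (nbh u :\ t1).
rewrite !inE e1 e2 eq_sym t12 /=; have := deg_le u.
by move=> du E2 E1; rewrite -ltnS; move: du; rewrite E1 E2; lia.
Qed.

(** An upper bound for the number of colours that the neighbours of x use once S
    has been precoloured by c and everything else is coloured arbitrarily. *)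
Definition colour_cost S c x := #|c @: (nbh x :&: S)| + #|nbh x :\: S|.

Lemma colour_cost_le S c x : colour_cost S c x <= #|nbh x|.
Proof. by rewrite -(cardsID S (nbh x)) leq_add2r leq_imset_card. Qed.

Lemma colour_cost0 c x : colour_cost set0 c x = #|nbh x|.
Proof. by rewrite /colour_cost setI0 imset0 cards0 setD0. Qed.

(** The end game. The two adjacent vertices v and w are kept for the end, w
    before v: when w is reached v is still uncoloured, so w needs one colour less
    than its degree allows, and v, which has no uncoloured neighbour left, needs
    two less. These savings come from small degrees or from neighbours in S that
    share a colour. *)
Lemma finish_colouring v w S c rk : e v w -> v \notin S -> w \notin S ->
  proper_on S c ->
  (forall u, u \notin S -> u != v -> u != w -> exists t1 t2,
     [/\ t1 != t2, e u t1, e u t2 &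
     {in [:: t1; t2], forall t, t \notin S /\ (t \in [:: v; w] \/ rk t < rk u)}]) ->
  colour_cost S c w <= n -> colour_cost S c v < n ->
  exists c', proper_on setT c'.
Proof.
move=> evw vS wS pc late costw costv.
have nvw : v != w by apply: contraTneq evw => ->; rewrite e_irr.
pose X := ~: (v |: (w |: S)).
have disX : [disjoint X & S].
  by apply/pred0P => x /=; rewrite !inE; case: (x \in S); rewrite ?orbT ?andbF.
have [u|c1 pc1 c1E] := @greedy_colouring2 X S rk c disX pc.
  rewrite !inE !negb_or => /and3P[uv uw uS].
  have [t1 [t2 [t12 e1 e2 tP]]] := late u uS uv uw.
  exists t1, t2; split=> // t tt; have [tS tl] := tP t tt; split=> //.
  by rewrite !inE !negb_or => /and3P[/negbTE tv /negbTE tw _]; case: tl; rewrite ?inE ?tv ?tw.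
have cE A x : {in S, c1 =1 c} ->
    c1 @: (nbh x :&: (A :|: S)) \subset c @: (nbh x :&: S) :|: c1 @: (nbh x :&: A :\: S).
  move=> E; apply/subsetP => _ /imsetP[t + ->]; rewrite !inE => /andP[et].
  case: (boolP (t \in S)) => tS => [_|].
    by rewrite E // imset_f // !inE et.
  by rewrite orbF => tA; rewrite orbC imset_f // !inE et tS.
have bound A x : #|c1 @: (nbh x :&: (A :|: S))| <=
    #|c @: (nbh x :&: S)| + #|nbh x :&: A :\: S|.
  apply: leq_trans (subset_leq_card (cE A x c1E)) _.
  apply: leq_trans (leq_card_setU _ _) _.
  by rewrite leq_add2l leq_imset_card.
have [||c2 pc2 c2E] := @proper_extend1 (X :|: S) c1 w _ pc1.
- by rewrite !inE eqxx orbT (negbTE wS).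
- apply: leq_ltn_trans (bound _ _) _; apply: leq_trans costw.
  rewrite ltn_add2l; apply/proper_card/properP; split.
    by apply/subsetP => t; rewrite !inE => /and3P[-> -> _].
  by exists v; rewrite !inE ?eqxx ?vS ?andbF // e_sym evw.
have [||c3 pc3 c3E] := @proper_extend1 (w |: (X :|: S)) c2 v _ pc2.
- by rewrite !inE eqxx (negbTE vS) (negbTE nvw).
- have c2S : {in S, c2 =1 c}.
    by move=> x xS; rewrite c2E ?c1E // inE xS orbT.
  have -> : w |: (X :|: S) = (w |: X) :|: S by rewrite setUA.
  apply: leq_ltn_trans costv.
  apply: (@leq_trans (#|c @: (nbh v :&: S)| + #|c2 @: (nbh v :&: (w |: X) :\: S)|)).
    apply: leq_trans (leq_card_setU _ _); apply/subset_leq_card/subsetP.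
    move=> _ /imsetP[t /setIP[et tA] ->].
    have [tS|tS] := boolP (t \in S).
      by rewrite in_setU c2S // imset_f // inE et.
    rewrite in_setU orbC imset_f // in_setD tS in_setI et /=.
    by move: tA; rewrite in_setU (negbTE tS) orbF.
  rewrite leq_add2l; apply: leq_trans (leq_imset_card _ _) _.
  by apply/subset_leq_card/subsetP => t; rewrite !inE => /and3P[-> -> _].
exists c3; apply: sub_in2 pc3 => x _; rewrite !inE.
by case: (x == v) => //=; case: (x == w) => //=; case: (x \in S).
Qed.

End Colouring.

(** * Distances, balls and walks *)

Section Distance.
Variable G : sgraph.
Hypothesis conG : forall x y : G, connect (@adj G) x y.
Implicit Types (u v w x y z : G) (p q : seq G).

Lemma adjC x y : adj x y = adj y x. Proof. exact: adj_sym. Qed.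

Lemma adj_neq x y : adj x y -> x != y.
Proof. by apply: contraTneq => ->; rewrite adj_irrefl. Qed.

Lemma distP k x y :
  reflect (exists p, [/\ path (@adj G) x p, last x p = y & size p <= k])
          (dist x y <= k).
Proof. exact: dist_leP. Qed.

Lemma dist_le0 x y : (dist x y <= 0) = (x == y).
Proof.
apply/distP/eqP => [[p [_ <-]]|->]; first by case: p.
by exists [::].
Qed.

Lemma dist_xx x : dist x x = 0.
Proof. by apply/eqP; rewrite -leqn0 dist_le0. Qed.

Lemma dist_eq0 x y : (dist x y == 0) = (x == y).
Proof. by rewrite -leqn0 dist_le0. Qed.

Lemma dist_leS k x y :
  reflect (x = y \/ exists2 z, adj x z & dist z y <= k) (dist x y <= k.+1).
Proof.
apply: (iffP (distP _ _ _)) => [[[|z p] /= [pp lp sp]]|[->|[z xz /distP[p [pp lp sp]]]]].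
- by left.
- case/andP: pp => xz pp; right; exists z => //; apply/distP.
  by exists p; rewrite -ltnS.
- by exists [::].
- by exists (z :: p); rewrite /= xz.
Qed.

Lemma dist_sym x y : dist x y = dist y x.
Proof.
have sub u v k : dist u v <= k -> dist v u <= k.
  case/distP=> p [pp lp sp]; apply/distP.
  exists (rev (belast u p)); split; last by rewrite size_rev size_belast.
    by rewrite -lp rev_path; under eq_path do rewrite adj_sym.
  by case: p lp {pp sp} => [|z p] /= lp; rewrite ?lp // rev_cons last_rcons.
by apply/eqP; rewrite eqn_leq; apply/andP; split; apply: sub.
Qed.

Lemma dist_triangle y x z : dist x z <= dist x y + dist y z.
Proof.
have /distP[p [pp lp sp]] := leqnn (dist x y).
have /distP[q [pq lq sq]] := leqnn (dist y z).
apply/distP; exists (p ++ q); rewrite cat_path pp lp last_cat lp lq.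
by rewrite size_cat leq_add.
Qed.

Lemma dist_adj x y : adj x y -> dist x y = 1.
Proof.
move=> xy; apply/eqP; rewrite eqn_leq; apply/andP; split.
  by apply/distP; exists [:: y]; rewrite /= xy.
by rewrite lt0n dist_eq0 adj_neq.
Qed.

Lemma dist_eq1 x y : (dist x y == 1) = adj x y.
Proof.
apply/eqP/idP; last exact: dist_adj.
move=> d1; have /dist_leS : dist x y <= 1 by rewrite d1.
case=> [xy|[z xz]]; first by move: d1; rewrite xy dist_xx.
by rewrite dist_le0 => /eqP <-.
Qed.

Lemma dist_step x y z k : adj x z -> dist z y <= k -> dist x y <= k.+1.
Proof. by move=> xz zy; apply/dist_leS; right; exists z. Qed.

Lemma dist_next k x y : dist x y = k.+1 -> exists2 z, adj x z & dist z y = k.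
Proof.
move=> dk; have /dist_leS[xy|[z xz zy]] : dist x y <= k.+1 by rewrite dk.
  by move: dk; rewrite xy dist_xx.
exists z => //; apply/eqP; rewrite eqn_leq zy -ltnS -dk /=.
by apply: dist_step xz _.
Qed.

Lemma dist_adj_le x y z : adj x y -> dist x z <= (dist y z).+1.
Proof. by move=> xy; apply: dist_step xy _. Qed.

Lemma power_adjE g x y : power_adj G g x y = (x != y) && (dist x y <= g).
Proof. by rewrite /power_adj conG. Qed.

Definition ball g x : {set G} := [set y | dist x y <= g].

Lemma ball_self g x : x \in ball g x.
Proof. by rewrite inE dist_xx. Qed.

Lemma ball_sym g x y : (x \in ball g y) = (y \in ball g x).
Proof. by rewrite !inE dist_sym. Qed.

Lemma nbh_power g x : nbh (power_adj G g) x = ball g x :\ x.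
Proof. by apply/setP => y; rewrite !inE power_adjE eq_sym. Qed.

Lemma card_nbh_power g x : #|nbh (power_adj G g) x| = #|ball g x|.-1.
Proof. by rewrite nbh_power (cardsD1 x (ball g x)) ball_self. Qed.

(** ** Nonbacktracking walks *)

(** The walk p starts at v, and u is the vertex visited just before v. A walk
    without a past is started with u = v, which excludes nothing because there
    are no loops. *)
Fixpoint nbpath u v p :=
  if p is x :: p' then [&& adj v x, x != u & nbpath v x p'] else true.

Lemma nbpath_path u v p : nbpath u v p -> path (@adj G) v p.
Proof. by elim: p u v => //= x p IH u v /and3P[-> _ /IH]. Qed.

Lemma nbpath_weak u v p : nbpath u v p -> nbpath v v p.
Proof.
by case: p => //= x p /and3P[vx _ ->]; rewrite vx eq_sym adj_neq.
Qed.

Lemma nbpath_cat u v p q :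
  nbpath u v (p ++ q) =
  nbpath u v p && nbpath (last u (belast v p)) (last v p) q.
Proof.
by elim: p u v => //= x p IH u v; rewrite IH -!andbA.
Qed.

Lemma nbpath_rcons u v p x :
  nbpath u v (rcons p x) =
  [&& nbpath u v p, adj (last v p) x & x != last u (belast v p)].
Proof. by rewrite -cats1 nbpath_cat /= andbT. Qed.

Lemma uniq_nbpath v p : path (@adj G) v p -> uniq (v :: p) -> nbpath v v p.
Proof.
have gen u : path (@adj G) v p -> uniq (v :: p) -> u \notin p -> nbpath u v p.
  elim: p u v => //= x p IH u v /andP[-> pp] /and3P[vp xp up].
  rewrite inE negb_or => /andP[ux _]; rewrite eq_sym ux /=.
  by apply: IH; rewrite //= ?xp //; move: vp; rewrite inE negb_or => /andP[].
by move=> pp up; apply: gen => //; case/andP: up.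
Qed.

Lemma dist_uniq_path k x y : dist x y <= k ->
  exists p, [/\ path (@adj G) x p, uniq (x :: p), last x p = y & size p <= k].
Proof.
case/distP => p [pp lp sp]; case: (shortenP pp) lp => q pq uq sub lq.
exists q; split=> //; apply: leq_trans sp; apply: uniq_leq_size => //.
by case/andP: uq.
Qed.

Lemma dist_nbpath k x y : dist x y <= k ->
  exists p, [/\ nbpath x x p, last x p = y & size p <= k].
Proof.
by case/dist_uniq_path => p [pp up lp sp]; exists p; split=> //; apply: uniq_nbpath.
Qed.

(** In a D-regular graph the vertices v with fewer than M neighbours in the g-th
    power are exactly the ambiguous ones: the nonbacktracking walks of length at
    most g from v, of which there are M + 1, do not all end at different
    vertices. *)
Definition ambiguous g v := exists p q,
  [/\ [/\ nbpath v v p & nbpath v v q], p <> q, last v p = last v q,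
      size p <= g & size q <= g].

(** Two walks from v with the same end and different first steps can be read as
    two walks from the first vertex w of one of them: drop w from that walk, and
    prepend v to the other one. *)
Lemma ambiguous_shift g v w p x q : nbpath v v (w :: p) -> nbpath v v q ->
  (head x q != w) -> (x != w) -> last v (w :: p) = last v q -> size p < g -> size q < g ->
  ambiguous g w.
Proof.
move=> /= /and3P[vw wv pp] pq hq xw E sp sq.
exists p, (v :: q); split=> //.
- split; first exact: nbpath_weak pp.
  rewrite /= adjC vw eq_sym wv /=.
  by case: q hq pq {E sq} => //= y q -> /and3P[-> _ ->].
- by move=> pE; move: pp; rewrite pE /= eqxx andbF.
- exact: ltnW.
Qed.

(** Ambiguity comes from a short closed walk and so spreads along it. A common
    first step can be dropped, and otherwise the start is moved one step along
    one walk; this makes the other walk one step longer, which is too long only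
    if both have length g. In that case the last step is moved as well. *)
Lemma ambiguous_nbr g v : 1 < g -> ambiguous g v ->
  exists2 w, adj v w & ambiguous g w.
Proof.
move=> g2 [p [q [[pp pq] npq E sp sq]]].
case: p pp npq E sp => [|w p] pp npq E sp.
  case: q pq npq E sq => // x q pq _ E sq.
  exists x; first by case/andP: pq.
  have vx : v != x by apply: adj_neq; case/andP: pq.
  by apply: (@ambiguous_shift g v x q v [::]) => //; apply: ltnW.
have vw : adj v w by case/andP: pp.
have nvw := adj_neq vw.
case: q pq npq E sq => [|x q] pq npq E sq.
  by exists w => //; apply: (@ambiguous_shift g v w p v [::]) => //; apply: ltnW.
have vx : adj v x by case/andP: pq.
have [wx|nwx] := eqVneq w x.
  subst x; exists w => //; exists p, q; split=> //.
  - by move: pp pq => /= /and3P[_ _ /nbpath_weak ?] /and3P[_ _ /nbpath_weak ?].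
  - by move=> pq'; rewrite pq' in npq.
  - exact: ltnW.
  - exact: ltnW.
have [sq'|sq'] := ltnP (size (x :: q)) g.
  by exists w => //; apply: (@ambiguous_shift g v w p x (x :: q)); rewrite //= eq_sym.
have [sp'|sp'] := ltnP (size (w :: p)) g.
  by exists x => //; apply: (@ambiguous_shift g v x q w (w :: p)).
have {sp sp'} sp : size (w :: p) = g by apply/eqP; rewrite eqn_leq sp.
have {sq sq'} sq : size (x :: q) = g by apply/eqP; rewrite eqn_leq sq.
exists w => //.
case/lastP: p pp npq E sp => [|p y] pp npq E sp; first by move: g2; rewrite -sp.
case/lastP: q pq npq E sq => [|q y'] pq npq E sq; first by move: g2; rewrite -sq.
have yy : y = y' by move: E; rewrite /= !last_rcons.
subst y'.
move: pp pq sp sq; rewrite -!rcons_cons => pp pq sp sq.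
have := pp; rewrite nbpath_rcons => /and3P[pp1 ly yp].
have := pq; rewrite nbpath_rcons => /and3P[pq1 ly' yq].
(* A common last step is dropped from both walks; distinct last steps from f
   and to f are turned round at the common end. *)
have [E'|NE] := eqVneq (last v (w :: p)) (last v (x :: q)).
  apply: (@ambiguous_shift g v w p x (x :: q)) => //; rewrite /= 1?eq_sym //.
    by move: sp; rewrite size_rcons /= => <-.
  by move: sq; rewrite size_rcons /= => <-.
set f := last v (x :: q) in NE ly' *.
exists (rcons (rcons p y) f), (v :: x :: q); split.
- split; last first.
    by move: pq1 => /= /and3P[-> _ ->]; rewrite adjC vw nvw eq_sym nwx.
  have : nbpath v v (rcons (rcons (w :: p) y) f).
    rewrite nbpath_rcons pp last_rcons belast_rcons adjC ly' /=.
    by rewrite eq_sym; apply: NE.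
  by rewrite !rcons_cons /= => /and3P[_ _ /nbpath_weak].
- move=> /(congr1 (head f)); case: (p) pp1 (pp) => [|p0 p'] /=.
    by move=> _ /and5P[_ _ _ /eqP H _] /H.
  by move=> /and5P[_ _ _ /eqP H _] _ /H.
- by rewrite last_rcons.
- by move: sp; rewrite !size_rcons /= => <-.
- by move: sq; rewrite size_rcons /= => <-.
Qed.

Fixpoint nbwalks k u v : seq (seq G) :=
  [::] :: (if k is k'.+1 then
     [seq x :: p | x <- enum [set x | adj v x & x != u], p <- nbwalks k' v x]
   else [::]).

Lemma mem_nbwalks k u v p :
  (p \in nbwalks k u v) = nbpath u v p && (size p <= k).
Proof.
elim: k u v p => [|k IH] u v [|x p] //=; first by rewrite inE andbF.
rewrite inE /=; apply/allpairsPdep/andP => [[y [q []]]|[/and3P[vx xu pp] sp]].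
  rewrite mem_enum inE => /andP[vy yu]; rewrite IH => /andP[pq sq] [-> ->].
  by rewrite vy yu pq.
by exists x, p; rewrite mem_enum inE vx xu IH pp.
Qed.

Lemma nbwalks_uniq k u v : uniq (nbwalks k u v).
Proof.
elim: k u v => [|k IH] u v //=; apply/andP; split.
  by apply/negP => /allpairsPdep[x [p []]].
apply: allpairs_uniq_dep => //; first exact: enum_uniq.
by move=> [x p] [y q] _ _ /= [-> ->].
Qed.

Lemma size_nbwalksS k u v : size (nbwalks k.+1 u v) =
  (\sum_(x in [set x | adj v x & x != u]) size (nbwalks k v x)).+1.
Proof.
rewrite /= size_allpairs_dep; congr _.+1.
by rewrite -big_enum /= sumnE big_map.
Qed.

Lemma ball_nbwalks g v :
  #|ball g v| = size (undup [seq last v p | p <- nbwalks g v v]).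
Proof.
rewrite -(card_uniqP (undup_uniq _)); apply: eq_card => y.
rewrite mem_undup inE; apply/idP/mapP => [/dist_nbpath[p [pp lp sp]]|[p]].
  by exists p; rewrite ?mem_nbwalks ?pp ?lp.
rewrite mem_nbwalks => /andP[/nbpath_path pp sp] ->.
by apply/distP; exists p.
Qed.

Lemma ball_le_nbwalks g v : #|ball g v| <= size (nbwalks g v v).
Proof. by rewrite ball_nbwalks (leq_trans (size_undup _)) ?size_map. Qed.

Lemma uniq_mapP (A B : eqType) (f : A -> B) (s : seq A) : uniq s ->
  reflect {in s &, injective f} (uniq (map f s)).
Proof.
move=> us; apply: (iffP idP) => [uf p q ps qs E|inj]; last by rewrite map_inj_in_uniq.
apply: contraTeq uf => npq.
rewrite (perm_uniq (perm_map f (perm_to_rem ps))) /= negb_and negbK.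
apply/orP; left; rewrite E; apply: map_f.
by rewrite (rem_filter _ us) mem_filter /= eq_sym npq.
Qed.

Lemma ambiguous_ball g v :
  ambiguous g v <-> #|ball g v| < size (nbwalks g v v).
Proof.
rewrite ball_nbwalks -(size_map (last v) (nbwalks g v v)) ltn_size_undup.
have un := nbwalks_uniq g v v.
split=> [[p [q [[pp pq] npq E sp sq]]]|nu].
  by apply/negP => /(uniq_mapP _ un) inj; apply/npq/inj; rewrite // mem_nbwalks ?pp ?pq.
have : ~~ allrel (fun p q => (last v p == last v q) ==> (p == q))
         (nbwalks g v v) (nbwalks g v v).
  apply: contra nu => /allrelP inj; apply/(uniq_mapP _ un) => p q ps qs E.
  by have := inj p q ps qs; rewrite E eqxx => /eqP.
case/allPn => p + /allPn[q]; rewrite !mem_nbwalks => /andP[pp sp] /andP[pq sq].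
by rewrite negb_imply => /andP[/eqP E /eqP npq]; exists p, q.
Qed.

Section Counting.
Variable D : nat.
Hypothesis D_gt2 : 2 < D.

Definition geo k := \sum_(i < k) (D - 1) ^ i.

Lemma geoS k : geo k.+1 = 1 + (D - 1) * geo k.
Proof.
rewrite /geo big_ord_recl expn0 big_distrr /=; congr (_ + _).
by apply: eq_bigr => i _; rewrite -expnS.
Qed.

Lemma geo0 : geo 0 = 0. Proof. by rewrite /geo big_ord0. Qed.

Lemma moore_boundE g : moore_bound D g = D * geo g.
Proof.
have D2 : 0 < D - 2 by rewrite subn_gt0.
have E : (D - 1) ^ g - 1 = (D - 2) * geo g by rewrite /geo !subn1 predn_exp subn2.
by rewrite /moore_bound E mulnCA mulKn.
Qed.

Lemma geo_gt0 k : 0 < k -> 0 < geo k.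
Proof. by case: k => // k _; rewrite geoS. Qed.

Lemma card_next u v :
  #|[set x | adj v x & x != u]| = degree v - adj v u.
Proof.
have -> : [set x | adj v x & x != u] = [set x | adj v x] :\ u.
  by apply/setP => x; rewrite !inE andbC.
by rewrite /degree (cardsD1 u [set y | adj v y]) inE addKn.
Qed.

Hypothesis deg_le : forall x : G, degree x <= D.

Lemma size_nbwalks_le k u v : adj v u -> size (nbwalks k u v) <= geo k.+1.
Proof.
elim: k u v => [|k IH] u v vu; first by rewrite geoS geo0.
rewrite size_nbwalksS geoS add1n ltnS.
apply: (@leq_trans (\sum_(x in [set x | adj v x & x != u]) geo k.+1)).
  by apply: leq_sum => x; rewrite inE => /andP[vx _]; apply: IH; rewrite adjC.
by rewrite sum_nat_const card_next vu leq_mul2r leq_sub2r ?orbT.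
Qed.

Lemma size_nbwalks0_le k v : size (nbwalks k.+1 v v) <= (degree v * geo k.+1).+1.
Proof.
rewrite size_nbwalksS ltnS.
apply: (@leq_trans (\sum_(x in [set x | adj v x & x != v]) geo k.+1)).
  apply: leq_sum => x; rewrite inE => /andP[vx _].
  by apply: size_nbwalks_le; rewrite adjC.
by rewrite sum_nat_const card_next adj_irrefl subn0.
Qed.

Lemma card_ball_le g v : 0 < g -> #|ball g v| <= (moore_bound D g).+1.
Proof.
case: g => // g _; apply: leq_trans (ball_le_nbwalks _ _) _.
apply: leq_trans (size_nbwalks0_le _ _) _.
by rewrite ltnS moore_boundE leq_mul2r deg_le orbT.
Qed.

(** Below a missing edge at v a whole branch of walks is missing. *)
Lemma card_ball_low g v : 1 < g -> degree v < D -> #|ball g v| < moore_bound D g.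
Proof.
case: g => // g g1 dv; apply: leq_ltn_trans (ball_le_nbwalks _ _) _.
apply: leq_ltn_trans (size_nbwalks0_le _ _) _.
rewrite moore_boundE; move: g1; case: g => // g _.
have : 1 < geo g.+2.
  by rewrite geoS -addn1 leq_add2l muln_gt0 subn_gt0 geo_gt0 // andbT ltnW.
by nia.
Qed.

(** The missing branch at v starts within distance 2 of w, hence shortens the
    list of walks from w too; here g >= 2 is needed. *)
Lemma card_ball_low_nbr g v w : 1 < g -> adj w v -> degree v < D ->
  #|ball g w| <= moore_bound D g.
Proof.
case: g => // -[//|g] _ wv dv; apply: leq_trans (ball_le_nbwalks _ _) _.
rewrite size_nbwalksS (bigD1 v) /=; last by rewrite inE wv eq_sym adj_neq.
have Hv : size (nbwalks g.+1 w v) < geo g.+2.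
  rewrite size_nbwalksS geoS add1n ltnS.
  apply: (@leq_ltn_trans ((degree v - 1) * geo g.+1)).
    apply: (@leq_trans (\sum_(x in [set x | adj v x & x != w]) geo g.+1)).
      apply: leq_sum => x; rewrite inE => /andP[vx _].
      by apply: size_nbwalks_le; rewrite adjC.
    by rewrite sum_nat_const card_next adjC wv.
  rewrite ltn_mul2r geo_gt0 //=.
  have : 0 < degree v by apply/card_gt0P; exists w; rewrite inE adjC.
  by move: dv; lia.
have Hr : \sum_(x in [set x | adj w x & x != w] | x != v)
    size (nbwalks g.+1 w x) <= (D - 1) * geo g.+2.
  apply: (@leq_trans (\sum_(x in [set x | adj w x & x != v]) geo g.+2)).
    rewrite (eq_bigl (fun x => x \in [set x | adj w x & x != v])); last first.
      move=> x; rewrite !inE; case: (boolP (adj w x)) => //= wx.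
      by rewrite eq_sym adj_neq.
    apply: leq_sum => x; rewrite inE => /andP[vx _].
    by apply: size_nbwalks_le; rewrite adjC.
  by rewrite sum_nat_const card_next wv leq_mul2r leq_sub2r ?orbT.
rewrite moore_boundE; apply: leq_trans (leq_add Hv Hr) _.
by rewrite -mulSn subn1 prednK // (ltn_trans _ D_gt2).
Qed.

End Counting.

Section Regular.
Variable D : nat.
Hypothesis D_gt2 : 2 < D.
Hypothesis reg : regular G D.

Lemma size_nbwalks k u v : adj v u -> size (nbwalks k u v) = geo D k.+1.
Proof.
elim: k u v => [|k IH] u v vu; first by rewrite geoS geo0 muln0.
rewrite size_nbwalksS [RHS]geoS add1n; congr _.+1.
rewrite (eq_bigr (fun=> geo D k.+1)).
  by rewrite sum_nat_const card_next vu reg.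
by move=> x; rewrite inE => /andP[vx _]; apply: IH; rewrite adjC.
Qed.

Lemma size_nbwalks0 g v : 0 < g -> size (nbwalks g v v) = (moore_bound D g).+1.
Proof.
case: g => // g _; rewrite size_nbwalksS moore_boundE //; congr _.+1.
rewrite (eq_bigr (fun=> geo D g.+1)).
  by rewrite sum_nat_const card_next adj_irrefl subn0 reg.
by move=> x; rewrite inE => /andP[vx _]; apply: size_nbwalks; rewrite adjC.
Qed.

Lemma ambiguousP g v : 0 < g -> ambiguous g v <-> #|ball g v| <= moore_bound D g.
Proof. by move=> g0; rewrite ambiguous_ball size_nbwalks0. Qed.

End Regular.
End Distance.

(** * Orders for the greedy colouring of a power *)

Section Cost.
Variables (T : finType) (e : rel T) (n : nat).
Implicit Types (S : {set T}) (c : T -> 'I_n).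

Lemma imsetD1_dup (A : {set T}) c a b : a \in A -> a != b -> c a = c b ->
  c @: A = c @: (A :\ b).
Proof.
move=> aA ab E; apply/eqP; rewrite eqEsubset andbC imsetS ?subD1set //=.
apply/subsetP => _ /imsetP[x xA ->].
have [->|xb] := eqVneq x b; last by rewrite imset_f // !inE xb.
by rewrite -E imset_f // !inE ab.
Qed.

Lemma colour_cost_pair S c x a b : a \in S -> b \in S -> e x a -> e x b ->
  a != b -> c a = c b -> colour_cost e S c x < #|nbh e x|.
Proof.
move=> aS bS xa xb ab E; rewrite /colour_cost -(cardsID S (nbh e x)) ltn_add2r.
have aA : a \in nbh e x :&: S by rewrite !inE xa.
rewrite (imsetD1_dup aA ab E).
rewrite [ltnRHS](cardsD1 b) !inE xb bS /= add1n ltnS; exact: leq_imset_card.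
Qed.

Lemma colour_cost_pair2 S c x a b a' b' : uniq [:: a; b; a'; b'] ->
  {in [:: a; b; a'; b'], forall y, y \in S /\ e x y} ->
  c a = c b -> c a' = c b' -> (colour_cost e S c x).+2 <= #|nbh e x|.
Proof.
move=> /and4P[]; rewrite !inE !negb_or => /and3P[ab aa' ab'] /andP[ba' bb'] a'b' _ sub E E'.
have inA y : y \in [:: a; b; a'; b'] -> y \in nbh e x :&: S.
  by move=> /sub[yS xy]; rewrite !inE xy.
rewrite /colour_cost -(cardsID S (nbh e x)) -!addSn leq_add2r.
have [aA bA a'A b'A] : [/\ a \in nbh e x :&: S, b \in nbh e x :&: S,
    a' \in nbh e x :&: S & b' \in nbh e x :&: S].
  by split; apply: inA; rewrite !inE eqxx ?orbT.
set A := nbh e x :&: S in aA bA a'A b'A *.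
rewrite (imsetD1_dup aA ab E).
have a'B : a' \in A :\ b by rewrite in_setD1 eq_sym ba'.
rewrite (imsetD1_dup a'B a'b' E').
rewrite (cardsD1 b A) bA (cardsD1 b' (A :\ b)) in_setD1 b'A eq_sym bb' /=.
by rewrite !add1n !ltnS leq_imset_card.
Qed.
End Cost.

Section Order.
Variable G : sgraph.
Hypothesis conG : forall x y : G, connect (@adj G) x y.
Variables (g n : nat).
Hypothesis g_ge2 : 1 < g.
Hypothesis ball_le : forall x : G, #|ball g x| <= n.+2.
Local Notation e := (power_adj G g).
Implicit Types (u v w x y z : G) (S : {set G}).

Definition colourable := exists c : G -> 'I_n, proper_on e setT c.

Let nbh_le u : #|nbh e u| <= n.+1.
Proof. by rewrite card_nbh_power // -ltnS prednK //; apply/card_gt0P; exists u; rewrite ball_self. Qed.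

Lemma power_adj_le k u v : u != v -> dist u v <= k -> k <= g -> e u v.
Proof. by move=> uv d kg; rewrite power_adjE // uv (leq_trans d). Qed.

Lemma dist2 u v w : adj u v -> adj v w -> dist u w <= 2.
Proof.
by move=> uv vw; apply: (dist_step conG uv); rewrite (dist_adj conG vw).
Qed.

Definition avoid S := [rel x y : G | [&& adj x y, x \notin S & y \notin S]].

(** The rank is the distance to v in the graph from which the edges at S have
    been removed. *)
Lemma rank_exists (S : {set G}) v : exists rk : G -> nat,
  forall u, u != v ->
    connect (avoid S) u v ->
    exists u', [/\ adj u u', u' \notin S, rk u' < rk u &
      connect (avoid S) u' v].
Proof.
pose r := avoid S.
have symr : symmetric r.
  by move=> x y /=; rewrite adj_sym; case: (x \in S); rewrite ?andbF ?andbT.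
have irr : irreflexive r by move=> x /=; rewrite adj_irrefl.
pose G' := SGraph symr irr.
exists (fun u => @dist G' u v) => u uv cuv.
have [[|u' p] [pp lp sp]] := @dist_leP G' u v (@dist G' u v) cuv (leqnn _).
  by move: uv; rewrite -lp eqxx.
move: pp => /= /andP[/and3P[uu' uS u'S] pp].
have cu' : connect r u' v by apply/connectP; exists p.
exists u'; split=> //; apply: leq_ltn_trans sp.
by apply/(@dist_leP G' u' v _ cu'); exists p.
Qed.

(** Distances to v inside G - S give an order in which every vertex has the next
    two vertices of a shortest path, or v and w, still uncoloured. *)
Lemma finish_connected v w S (c : G -> 'I_n) : adj v w -> v \notin S -> w \notin S ->
  proper_on e S c ->
  (forall u, u \notin S ->
    connect (avoid S) u v) ->
  colour_cost e S c w <= n -> colour_cost e S c v < n -> colourable.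
Proof.
move=> vw vS wS pc con cw cv.
have [rk rkP] := rank_exists S v.
have eS := @power_adj_sym G g; have eI := @power_adj_irrefl G g.
have nvw := adj_neq vw.
apply: (finish_colouring (rk := rk) eS eI nbh_le _ vS wS pc _ cw cv).
  by apply: power_adj_le (nvw) _ (ltnW g_ge2); rewrite dist_adj.
move=> u uS uv uw; have [u1 [uu1 u1S rk1 con1]] := rkP u uv (con u uS).
have [u1v|u1v] := eqVneq u1 v.
  subst u1; exists v, w; split => //.
  - by apply: (power_adj_le uv _ (ltnW g_ge2)); rewrite dist_adj.
  - by apply: (power_adj_le uw _ g_ge2); apply: dist2 vw.
  - by move=> t; rewrite !inE => /orP[]/eqP->; (split; [by [] | left; rewrite eqxx ?orbT]).
have [u2 [u12 u2S rk2 _]] := rkP u1 u1v con1.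
exists u1, u2; split; first exact: adj_neq.
- by apply: (power_adj_le (adj_neq uu1) _ (ltnW g_ge2)); rewrite dist_adj.
- apply: power_adj_le (dist2 uu1 u12) g_ge2.
  by apply: contraTneq rk2 => <-; rewrite -leqNgt ltnW.
- by move=> t; rewrite !inE => /orP[]/eqP->; split=> //; right => //; apply: ltn_trans rk1.
Qed.

(** Two adjacent vertices with two and one missing neighbours supply all savings,
    so nothing has to be precoloured. *)
Lemma colourable_low v w : adj v w -> #|ball g v| <= n -> #|ball g w| <= n.+1 ->
  colourable.
Proof.
move=> vw bv bw.
have n0 : 0 < n.
  by apply: leq_trans bv; apply/card_gt0P; exists v; rewrite ball_self.
have cost x : colour_cost e set0 (fun=> Ordinal n0) x = #|ball g x|.-1.
  by rewrite colour_cost0 card_nbh_power.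
apply: (@finish_connected v w set0 (fun=> Ordinal n0)); rewrite ?inE ?cost //.
- by move=> x y; rewrite inE.
- move=> u _; apply: connect_sub (conG u v) => x y xy; apply: connect1.
  by rewrite /= xy !inE.
- by case: #|_| bw.
- by case: #|_| bv => [|k]; rewrite ?n0.
Qed.

Definition pair_colouring (n2 : 1 < n) a b : G -> 'I_n :=
  fun x => if x \in [set a; b] then Ordinal (ltnW n2) else Ordinal n2.

Lemma proper_pair (n2 : 1 < n) a b a' b' : uniq [:: a; b; a'; b'] ->
  ~~ e a b -> ~~ e a' b' ->
  proper_on e [set a; b; a'; b'] (pair_colouring n2 a b).
Proof.
move=> /and4P[]; rewrite !inE !negb_or => /and3P[ab aa' ab'] /andP[ba' bb'] a'b' _.
move=> nab nab' x y xS yS exy; rewrite /pair_colouring.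
have nba : ~~ e b a by rewrite power_adj_sym.
have nba' : ~~ e b' a' by rewrite power_adj_sym.
case: ifP => xab; case: ifP => yab //; exfalso.
  move: xab yab exy; rewrite !inE => /orP[]/eqP-> /orP[]/eqP->;
  by rewrite ?power_adj_irrefl ?(negbTE nab) ?(negbTE nba).
move: xS yS xab yab exy; rewrite !inE -!orbA.
case/or4P=> /eqP-> /or4P[]/eqP->; rewrite ?eqxx ?orbT //=;
by rewrite ?power_adj_irrefl ?(negbTE nab') ?(negbTE nba').
Qed.

(** Two pairs of vertices, each at distance more than g from its mate and going to
    receive the same colour: both pairs are seen by v, which gives its two savings, and one of them
    is seen by w, which gives the saving of w. *)
Record config v w a b a' b' : Prop := Config {
  cfg_vw : adj v w;
  cfg_uniq : uniq [:: a; b; a'; b'];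
  cfg_ab : ~~ e a b;
  cfg_ab' : ~~ e a' b';
  cfg_v : {in [:: a; b; a'; b'], forall x, e v x};
  cfg_wa : e w a;
  cfg_wb : e w b;
  cfg_w : w \notin [:: a; b; a'; b'] }.

Lemma config_v v w a b a' b' : config v w a b a' b' -> v \notin [:: a; b; a'; b'].
Proof. by move=> c; apply/negP => /(cfg_v c); rewrite power_adj_irrefl. Qed.

Lemma config_set a b a' b' x : (x \in [set a; b; a'; b']) = (x \in [:: a; b; a'; b']).
Proof. by rewrite !inE -!orbA. Qed.

Lemma config_cost (n2 : 1 < n) v w a b a' b' : config v w a b a' b' ->
  let c := pair_colouring n2 a b in let S := [set a; b; a'; b'] in
  [/\ proper_on e S c, colour_cost e S c w <= n & colour_cost e S c v < n].
Proof.
move=> cf c S; split; first exact: proper_pair (cfg_uniq cf) (cfg_ab cf) (cfg_ab' cf).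
  rewrite -ltnS; apply: leq_trans (nbh_le w).
  apply: (colour_cost_pair (a := a) (b := b)); rewrite ?inE ?eqxx ?orbT //.
  - exact: cfg_wa cf.
  - exact: cfg_wb cf.
  - by case/andP: (cfg_uniq cf); rewrite !inE !negb_or => /andP[].
  - by rewrite /c /pair_colouring !inE !eqxx orbT.
rewrite -ltnS; apply: leq_trans (nbh_le v).
apply: (colour_cost_pair2 (cfg_uniq cf)).
- by move=> x xS; rewrite config_set xS (cfg_v cf).
- by rewrite /c /pair_colouring !inE !eqxx orbT.
case/and4P: (cfg_uniq cf); rewrite !inE !negb_or => /and3P[ab aa' ab'] /andP[ba' bb'] _ _.
by rewrite /c /pair_colouring !inE ![a' == _]eq_sym ![b' == _]eq_sym
  (negbTE aa') (negbTE ab') (negbTE ba') (negbTE bb').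
Qed.

Lemma config_connected v w a b a' b' : 1 < n -> config v w a b a' b' ->
  let S := [set a; b; a'; b'] in
  (forall u, u \notin S ->
    connect (avoid S) u v) ->
  colourable.
Proof.
move=> n2 cf S con; have [pc cw cv] := config_cost n2 cf.
apply: (finish_connected (cfg_vw cf) _ _ pc) => //; rewrite config_set.
  exact: config_v cf.
exact: cfg_w cf.
Qed.

(** For g >= 3 no connectivity of G - S is required. On a geodesic from u to v the
    next three vertices are all neighbours of u in the power, and S is so sparse
    that at most two consecutive ones are precoloured; in that case the middle
    vertex u2 of the three has a further neighbour, which is also within distance
    3 of u and closer to v than u. *)
Lemma finish_pow3 v w S (c : G -> 'I_n) : 2 < g -> (forall x, 2 < degree x) ->
  adj v w -> v \notin S -> w \notin S -> proper_on e S c ->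
  {in S &, forall s t, s != t -> dist s t <= 2 -> adj s t} ->
  {in S & &, forall s t t', adj s t -> adj s t' -> t = t'} ->
  colour_cost e S c w <= n -> colour_cost e S c v < n -> colourable.
Proof.
move=> g3 deg3 vw vS wS pc near2 one cw cv.
have eS := @power_adj_sym G g; have eI := @power_adj_irrefl G g.
have nvw := adj_neq vw.
apply: (finish_colouring (rk := fun u => dist u v) eS eI nbh_le _ vS wS pc _ cw cv).
  by apply: power_adj_le (nvw) _ (ltnW g_ge2); rewrite dist_adj.
move=> u uS uv uw.
have duw : dist u w <= (dist u v).+1.
  by apply: leq_trans (dist_triangle conG v _ _) _; rewrite (dist_adj conG vw) addn1.
case d: (dist u v) => [|[|[|k]]].
- by move/eqP: d; rewrite dist_eq0 // (negbTE uv).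
- exists v, w; split => //.
  + by apply: (power_adj_le uv _ (ltnW g_ge2)); rewrite d.
  + by apply: (power_adj_le uw _ g_ge2); rewrite -d.
  + by move=> t; rewrite !inE => /orP[]/eqP->; (split; [by [] | left; rewrite eqxx ?orbT]).
- exists v, w; split => //.
  + by apply: (power_adj_le uv _ g_ge2); rewrite d.
  + by apply: (power_adj_le uw _ g3); rewrite -d.
  + by move=> t; rewrite !inE => /orP[]/eqP->; (split; [by [] | left; rewrite eqxx ?orbT]).
have [u1 uu1 d1] := dist_next conG d.
have [u2 u12 d2] := dist_next conG d1.
have [u3 u23 d3] := dist_next conG d2.
have near t m : dist t v <= k.+2 -> dist u t <= m -> m <= 3 -> e u t.
  move=> dt dut m3; apply: power_adj_le dut (leq_trans m3 g3).
  by apply: contraTneq dt => <-; rewrite d ltnn.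
have e1 : e u u1 by apply: near (_ : _ <= 1) _; rewrite ?d1 ?dist_adj.
have e2 : e u u2 by apply: near (dist2 uu1 u12) _; rewrite ?d2.
have e3 : e u u3.
  by apply: near (dist_step conG uu1 (dist2 u12 u23)) _; rewrite // d3 -addn2 leq_addr.
have n12 : u1 != u2 by exact: adj_neq.
have n23 : u2 != u3 by exact: adj_neq.
have n13 : u1 != u3 by apply/eqP => E13; move: d1; rewrite E13 d3; clear; lia.
have fin t1 t2 : t1 != t2 -> e u t1 -> e u t2 -> t1 \notin S -> t2 \notin S ->
    dist t1 v <= k.+2 -> dist t2 v <= k.+2 ->
    exists t1 t2, [/\ t1 != t2, e u t1, e u t2 &
     {in [:: t1; t2], forall t, t \notin S /\ (t \in [:: v; w] \/ dist t v < k.+3)}].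
  move=> *; exists t1, t2; split=> // t; rewrite !inE => /orP[]/eqP->;
  by split=> //; right.
have l1 : dist u1 v <= k.+2 by rewrite d1.
have l2 : dist u2 v <= k.+2 by rewrite d2.
have l3 : dist u3 v <= k.+2 by rewrite d3 -addn2 leq_addr.
have [u2S|u2S] := boolP (u2 \in S); last first.
  have [u1S|u1S] := boolP (u1 \in S); last exact: (fin u1 u2).
  have [u3S|u3S] := boolP (u3 \in S); last exact: (fin u2 u3).
  have a13 := near2 _ _ u1S u3S n13 (dist2 u12 u23).
  by have := dist_adj_le conG v a13; rewrite d1 d3 ltnn.
(* A neighbour of u2 off the geodesic replaces a second precoloured vertex. *)
have [x xP] : exists x, [/\ adj u2 x, x != u1 & x != u3].
  have : 0 < #|[set y | adj u2 y] :\ u1 :\ u3|.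
    have := deg3 u2; rewrite /degree (cardsD1 u1) (cardsD1 u3 (_ :\ u1)).
    by do 2!case: (_ \in _) => /=; rewrite ?add1n ?add0n //; case: #|_|.
  by case/card_gt0P => x; rewrite !inE => /and3P[? ? ?]; exists x.
case: xP => a2x x1 x3.
have lx : dist x v <= k.+2.
  by apply: leq_trans (dist_adj_le conG v (_ : adj x u2)) _; rewrite 1?adjC ?d2.
have ex : e u x by apply: near (dist_step conG uu1 (dist2 u12 a2x)) _.
have a21 : adj u2 u1 by rewrite adjC.
have [u1S|u1S] := boolP (u1 \in S).
  have u3S : u3 \notin S.
    by apply: contraNN n13 => u3S; rewrite (one u2 u1 u3).
  have xS : x \notin S by apply: contraNN x1 => xS; rewrite (one u2 x u1).
  by apply: (fin u3 x); rewrite // eq_sym.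
have [u3S|u3S] := boolP (u3 \in S); last exact: (fin u1 u3).
have xS : x \notin S by apply: contraNN x3 => xS; rewrite (one u2 x u3).
by apply: (fin u1 x); rewrite // eq_sym.
Qed.

End Order.

(** * Regular graphs, and powers of exponent at least 3 *)

(** Each edge is counted once at its end of smaller rank and once at the other. *)
Lemma handshake (G : sgraph) : ~~ odd (\sum_(x : G) degree x).
Proof.
pose lt (x y : G) := enum_rank x < enum_rank y.
pose f (x y : G) : nat := adj x y.
have dE x : degree x = \sum_(y | lt x y) f x y + \sum_(y | lt y x) f x y.
  have -> : degree x = \sum_y f x y.
    by rewrite /degree -sum1_card big_mkcond; apply: eq_bigr => y _; rewrite inE /f; case: (adj x y).
  rewrite (bigID (lt x)) /=; congr (_ + _).
  rewrite (bigID (fun y => lt y x)) /= [X in _ + X]big1 ?addn0.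
    by apply: eq_bigl => y; rewrite /lt; case: ltngtP.
  move=> y; rewrite /lt -!leqNgt -eqn_leq => /eqP/val_inj/enum_rank_inj ->.
  by rewrite /f adj_irrefl.
rewrite (eq_bigr _ (fun x _ => dE x)) big_split /=.
rewrite [X in _ + X](exchange_big_dep xpredT) //=.
rewrite [X in _ + X](eq_bigr (fun x => \sum_(y | lt x y) f x y)).
  by rewrite addnn odd_double.
by move=> y _; apply: eq_bigr => x _; rewrite /f adj_sym.
Qed.

Lemma regular_odd_order (G : sgraph) D : regular G D -> odd D -> ~~ odd #|G|.
Proof.
move=> reg oD; have := handshake G; rewrite (eq_bigr (fun=> D)) => [|x _]; last exact: reg.
by rewrite sum_nat_const oddM oD andbT.
Qed.

Lemma odd_moore_bound D g : 2 < D -> odd D -> 0 < g -> odd (moore_bound D g).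
Proof.
move=> D2 oD; case: g => // g _; rewrite moore_boundE // oddM oD /= geoS.
by rewrite oddD oddM oddB ?oD // (ltn_trans _ D2).
Qed.

Section RegularPower.
Variable G : sgraph.
Hypothesis conG : forall x y : G, connect (@adj G) x y.
Variables (g n D : nat).
Hypotheses (g_ge2 : 1 < g) (D_gt2 : 2 < D) (reg : regular G D).
Hypothesis Mn : moore_bound D g = n.+1.
Local Notation e := (power_adj G g).
Local Notation amb := (@ambiguous G g).
Local Notation colourable := (colourable G g n).
Implicit Types (u v w x y z : G) (S : {set G}).

Let g_gt0 : 0 < g := ltnW g_ge2.

Lemma ball_leM x : #|ball g x| <= n.+2.
Proof. by rewrite -Mn; apply: card_ball_le => // y; rewrite reg. Qed.

Lemma ambP x : amb x <-> #|ball g x| <= n.+1.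
Proof. by rewrite -Mn; apply: ambiguousP. Qed.

Lemma nbh_card x : #|nbh e x| = #|ball g x|.-1.
Proof. exact: card_nbh_power. Qed.

(** A vertex that misses two neighbours is ambiguous, hence has an ambiguous
    neighbour, which misses one. *)
Lemma colourable_deficit2 v : #|ball g v| <= n -> colourable.
Proof.
move=> bv; have /(ambiguous_nbr g_ge2)[w vw /ambP bw] : amb v by apply/ambP; rewrite ltnW.
exact: (colourable_low conG g_ge2 ball_leM vw).
Qed.

Hypothesis ball_ge : forall x, n.+1 <= #|ball g x|.

Lemma amb_card x : amb x -> #|ball g x| = n.+1.
Proof. by move/ambP => bx; apply/eqP; rewrite eqn_leq bx ball_ge. Qed.

Lemma notamb_card x : ~ amb x -> #|ball g x| = n.+2.
Proof.
move=> nx; apply/eqP; rewrite eqn_leq ball_leM ltnNge.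
by apply/negP => /ambP.
Qed.

(** The ball K of v has order M. A vertex x of K adjacent to some t outside K has
    M - 1 neighbours in K, so t is its only neighbour outside K; the neighbours of
    t are within distance 2 of x, so they lie in K and the same holds for them.
    They are therefore not ambiguous, so neither is t, whose ball must then be
    K and t: but v, which misses t, cannot lie in it. *)
Lemma clique_ball_setT v : amb v ->
  {in ball g v &, forall a b, a != b -> e a b} -> ball g v = setT.
Proof.
move=> av cl; apply/eqP; rewrite eqEsubset subsetT /=; apply/subsetP => t0 _.
have cK : #|ball g v| = n.+1 := amb_card av.
have sub x : x \in ball g v -> ball g v \subset ball g x.
  move=> xK; apply/subsetP => y yK; have [->|xy] := eqVneq y x; first exact: ball_self.
  by move: (cl x y xK yK); rewrite eq_sym xy power_adjE // inE => /(_ isT)/andP[].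
have out x t : x \in ball g v -> t \notin ball g v -> t \in ball g x ->
    ~ amb x /\ ball g x = t |: ball g v.
  move=> xK tK tx; have sub' : t |: ball g v \subset ball g x by rewrite subUset sub1set tx sub.
  have cU : #|t |: ball g v| = n.+2 by rewrite cardsU1 tK cK.
  split; last by apply/esym/eqP; rewrite eqEcard sub' cU ball_leM.
  by move/amb_card => cx; have := subset_leq_card sub'; rewrite cU cx ltnn.
have step x t : x \in ball g v -> adj x t -> t \in ball g v.
  move=> xK xt; apply/negPn/negP => tK.
  have tx : t \in ball g x by rewrite inE dist_adj.
  have [nax Bx] := out x t xK tK tx.
  have nb y : adj t y -> ~ amb y /\ ball g y = t |: ball g v.
    move=> ty; have yK : y \in ball g v.
      have : y \in ball g x by rewrite inE (leq_trans (dist2 conG xt ty)).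
      rewrite Bx !inE => /orP[/eqP yt|//]; by move: ty; rewrite yt adj_irrefl.
    by apply: out yK tK _; rewrite ball_sym // inE dist_adj.
  have nat_ : ~ amb t by move/(ambiguous_nbr g_ge2) => [y /nb[]].
  have subt : ball g t \subset t |: ball g v.
    apply/subsetP => s; rewrite inE; case: g g_gt0 nb => // k _ nb.
    case/dist_leS => // [<-|[y ty ys]]; first by rewrite !inE eqxx.
    by have [_ <-] := nb y ty; rewrite inE ltnW.
  have Bt : ball g t = t |: ball g v.
    by apply/eqP; rewrite eqEcard subt cardsU1 tK cK (notamb_card nat_) add1n leqnn.
  by move: tK; rewrite ball_sym // Bt !inE dist_xx // orbT.
have /connectP[p] := conG v t0.
elim/last_ind: p t0 => [|p y IH] t0; first by move=> _ ->; rewrite ball_self.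
rewrite rcons_path last_rcons => /andP[pp ly] ->.
exact: step (IH _ pp erefl) ly.
Qed.

Section PowerGe3.
Hypothesis g_ge3 : 2 < g.

Let deg3 x : 2 < degree x. Proof. by rewrite reg. Qed.

Lemma notin_power a b : a != b -> ~~ e a b -> g < dist a b.
Proof. by move=> ab; rewrite power_adjE // ab /= -ltnNge. Qed.

(** One saving of v is its missing neighbour, the other one the pair a, b. *)
Lemma finish_ambiguous_pair v w a b : adj v w -> amb v -> (amb w \/ e w a /\ e w b) ->
  e v a -> e v b -> a != b -> ~~ e a b -> w \notin [set a; b] -> colourable.
Proof.
move=> vw av wP va vb ab nab wS.
have n0 : 0 < n.
  have := amb_card av; rewrite (cardsD1 v) ball_self // (cardsD1 a).
  suff -> : a \in ball g v :\ v by case: n.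
  by move: va; rewrite power_adjE // !inE eq_sym.
have far := notin_power ab nab.
have far' : g < dist b a by rewrite dist_sym.
have cost x : e x a -> e x b -> colour_cost e [set a; b] (fun=> Ordinal n0) x < #|ball g x|.-1.
  move=> xa xb; rewrite -nbh_card.
  by apply: (colour_cost_pair (a := a) (b := b)); rewrite ?inE ?eqxx ?orbT.
have nadj : {in [set a; b] &, forall s t, s != t -> g < dist s t}.
  by move=> s t; rewrite !inE => /orP[]/eqP-> /orP[]/eqP->; rewrite ?eqxx.
apply: (finish_pow3 conG g_ge2 ball_leM g_ge3 deg3 vw _ wS
  (c := fun=> Ordinal n0)).
- rewrite !inE negb_or; apply/andP; split.
    by apply: contraTneq va => ->; rewrite power_adj_irrefl.
  by apply: contraTneq vb => ->; rewrite power_adj_irrefl.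
- move=> s t; rewrite !inE => /orP[]/eqP-> /orP[]/eqP->;
  by rewrite ?power_adj_irrefl ?(negbTE nab) // power_adj_sym (negbTE nab).
- move=> s t sS tS st d2; have := leq_trans (nadj s t sS tS st) d2.
  by rewrite ltnNge ltnW.
- move=> s t t' sS tS _ st; exfalso.
  have := nadj s t sS tS (adj_neq st); rewrite (dist_adj conG st).
  by rewrite ltnNge g_gt0.
- case: wP => [aw|[wa wb]].
    by apply: leq_trans (colour_cost_le _ _ _ _) _; rewrite nbh_card amb_card.
  rewrite -ltnS; apply: leq_trans (cost w wa wb) _.
  by have := ball_leM w; case: #|_|.
- by apply: leq_trans (cost v va vb) _; rewrite amb_card.
Qed.

(** If the ball of v is a clique it is the whole graph, and then a D-regular graph
    of order M exists, which parity forbids. Otherwise v sees a pair a, b at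
    distance more than g. An ambiguous neighbour w of v serves unless it belongs
    to the pair, and then the first vertex on a geodesic from v to the other
    element of the pair sees both of them. *)
Lemma colourable_ambiguous_ge3 v : odd D -> amb v -> colourable.
Proof.
move=> oD av; have [w vw aw] := ambiguous_nbr g_ge2 av.
have [cl|] := boolP [forall a in ball g v, forall b in ball g v, (a != b) ==> e a b].
  have BT : ball g v = setT.
    apply: clique_ball_setT av _ => a b aK bK ab.
    by move/forall_inP: cl => /(_ a aK)/forall_inP/(_ b bK)/implyP/(_ ab).
  have := regular_odd_order reg oD.
  by rewrite -cardsT -BT amb_card // -Mn odd_moore_bound.
rewrite negb_forall_in => /exists_inP[a aK]; rewrite negb_forall_in => /exists_inP[b bK].
rewrite negb_imply => /andP[ab nab].
have inE' c d : c != d -> ~~ e c d -> c \in ball g v -> d \in ball g v -> e v c.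
  move=> cd ncd cK dK; rewrite power_adjE //; move: cK dK; rewrite !inE => -> dK.
  rewrite andbT; apply: contraNneq ncd => vc; by rewrite power_adjE // cd -vc.
have va : e v a by apply: inE' ab nab aK bK.
have nba : ~~ e b a by rewrite power_adj_sym.
have vb : e v b by apply: inE' nba bK aK; rewrite eq_sym.
have [wS|wS] := boolP (w \in [set a; b]); last first.
  by apply: finish_ambiguous_pair vw av (or_introl aw) va vb ab nab wS.
have aux a' b' : w = a' -> e v a' -> e v b' -> a' != b' -> ~~ e a' b' -> colourable.
  move=> wa va' vb' ab' nab'; have vwa : adj v a' by rewrite -wa.
  have far := notin_power ab' nab'.
  case d : (dist v b') => [|j].
    by move: d => /eqP; rewrite dist_eq0 // => /eqP vE; rewrite -vE power_adj_irrefl in vb'.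
  have jg : j < g by move: vb'; rewrite power_adjE // d => /andP[].
  have [x vx dx] := dist_next conG d.
  have xa : x != a'.
    by apply: contraTneq far => <-; rewrite dx -leqNgt ltnW.
  have da : dist x a' <= 2 by apply: dist2 vwa; rewrite // adjC.
  have xb : x != b'.
    apply: contraTneq far => <-; rewrite -leqNgt dist_sym //.
    exact: leq_trans da g_ge2.
  apply: (finish_ambiguous_pair vx av _ va' vb' ab' nab'); last first.
    by rewrite !inE negb_or xa.
  right; rewrite !power_adjE // xa xb dx (ltnW jg); split=> //=.
  exact: leq_trans da g_ge2.
move: wS; rewrite !inE => /orP[]/eqP wE; first exact: aux wE va vb ab nab.
by apply: (aux b a); rewrite // eq_sym.
Qed.

End PowerGe3.

Section Unambiguous.
Hypothesis noamb : forall x, ~ amb x.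

(** The term last x (belast x p) is the last but one vertex of the walk, or its
    start if the walk is empty. *)
Lemma dist_penult x p : path (@adj G) x p ->
  dist x (last x (belast x p)) <= (size p).-1.
Proof.
case/lastP: p => [|p y] /=; first by rewrite dist_xx.
rewrite rcons_path belast_rcons size_rcons => /andP[pp _] /=.
by apply/distP => //; exists p.
Qed.

(** Suppose that every neighbour z of y is within distance g of x1. A geodesic
    from x1 to z has a first vertex phi z, and this is not x0, which is too far
    from y. By unambiguity phi is injective, since two values z with the same
    image would give two walks from that image to y. So D vertices inject into
    D - 1. *)
Lemma geodesic_extend x0 x1 y : adj x0 x1 -> dist x0 y = g.+1 -> dist x1 y = g ->
  exists2 z, adj y z & g < dist x1 z.
Proof.
move=> x01 d0 d1.
have [/exists_inP[z]|] := boolP [exists z in [set z | adj y z], g < dist x1 z].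
  by rewrite inE; exists z.
rewrite negb_exists_in => /forall_inP near; exfalso.
pose Q z p := adj x1 p && (dist p z < g).
have exQ z : adj y z -> exists p, Q z p.
  move=> yz; have := near z; rewrite inE yz -leqNgt => /(_ isT) dz.
  case d : (dist x1 z) => [|j].
    move/eqP: d; rewrite dist_eq0 // => /eqP E; move: d1.
    by rewrite E dist_sym // dist_adj // => E1; move: g_ge2; rewrite -E1.
  by have [p xp dp] := dist_next conG d; exists p; rewrite /Q xp dp -d.
pose phi z := odflt x1 [pick p | Q z p].
have phiP z : adj y z -> Q z (phi z).
  by move=> /exQ[p Qp]; rewrite /phi; case: pickP => [//|/(_ p)]; rewrite Qp.
have far p : adj x1 p -> g.-1 <= dist p y.
  by move=> xp; have := dist_adj_le conG y xp; rewrite d1; case: g.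
have walk p z : adj x1 p -> adj y z -> dist p z < g ->
    exists2 q, nbpath p p (rcons q y) & last p q = z /\ size (rcons q y) <= g.
  move=> xp yz dz.
  have /(dist_nbpath conG)[q [nq lq sq]] : dist p z <= g.-1 by rewrite -ltnS prednK.
  exists q; last by rewrite size_rcons -(prednK g_gt0) ltnS.
  rewrite nbpath_rcons nq lq adjC yz /=; apply/eqP => E.
  have := dist_penult (nbpath_path nq); rewrite -E.
  move/(leq_trans (far p xp)); move: sq g_ge2; case: (size q) => [|m] /=; first by case: g => [|[]].
  by move=> sq _; rewrite leqNgt sq.
have inj : {in [set z | adj y z] &, injective phi}.
  move=> z z'; rewrite !inE => yz yz' E; apply/eqP/negPn/negP => nz.
  have /andP[xp dz] := phiP z yz; have /andP[_ dz'] := phiP z' yz'.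
  rewrite -E in dz'.
  have [q nq [lq sq]] := walk _ _ xp yz dz.
  have [q' nq' [lq' sq']] := walk _ _ xp yz' dz'.
  apply: (noamb (x := phi z)); exists (rcons q y), (rcons q' y); split=> //.
    by move/rcons_inj => [qq]; move: nz; rewrite -lq -lq' qq eqxx.
  by rewrite !last_rcons.
have sub : phi @: [set z | adj y z] \subset [set z | adj x1 z] :\ x0.
  apply/subsetP => _ /imsetP[z + ->]; rewrite !inE => yz.
  have /andP[-> dz] := phiP z yz; rewrite andbT.
  apply: contraTneq dz => ->; rewrite -leqNgt -ltnS -d0.
  apply: leq_trans (dist_triangle conG z _ _) _.
  by rewrite (@dist_adj _ conG z y) ?addn1 // adjC.
have := subset_leq_card sub; rewrite card_in_imset //.
have -> : #|[set z | adj y z]| = D by exact: reg.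
have := reg x1; rewrite /degree (cardsD1 x0) inE adjC x01 => <-.
by rewrite add1n ltnn.
Qed.

Lemma dist_exact k x y : k <= dist x y -> exists z, dist z y = k.
Proof.
move: {2}(dist x y) (erefl (dist x y)) => m; elim: m x => [|m IH] x d kd.
  by exists x; move: kd; rewrite d; case: k.
move: kd; rewrite leq_eqVlt => /orP[/eqP kd|]; first by exists x.
rewrite d ltnS; have [z xz dz] := dist_next conG d.
by move=> km; apply: (IH z) => //; rewrite dz.
Qed.

(** Take a geodesic x0, x1, x2, x3, ... , y of length g + 1 and prolong it by z
    with x1 and z at distance more than g. The pairs x0, y and x1, z are both seen
    by x2, and x3 sees the first one. The four vertices form two adjacent couples
    that are far apart, as the ordering for g >= 3 demands. *)
Lemma colourable_unambiguous_ge3 x y : 2 < g -> g < dist x y -> colourable.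
Proof.
move=> g3 /dist_exact[x0 d0].
have [x1 a01 d1] := dist_next conG d0.
have [z yz dz] := geodesic_extend a01 d0 d1.
case gE : g g3 d0 d1 => [|[|[|k]]] // _ d0 d1.
have [x2 a12 d2] := dist_next conG d1.
have [x3 a23 d3] := dist_next conG d2.
have dzy : dist z y = 1 by rewrite dist_adj // adjC.
have neq_dist a b : dist a y != dist b y -> a != b by apply: contraNneq => ->.
have d02 := dist2 conG a01 a12.
have d13 := dist2 conG a12 a23.
have d03 : dist x0 x3 <= 3 by apply: dist_step a01 d13.
have g3 : 2 < g by rewrite gE.
have n1z : x1 != z by apply: contraTneq dz => ->; rewrite dist_xx.
have n01 : x0 != x1 := adj_neq a01.
have n0y : x0 != y by rewrite neq_dist // d0 dist_xx.
have n0z : x0 != z by rewrite neq_dist // d0 dzy.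
have ny1 : y != x1 by rewrite neq_dist // d1 dist_xx.
have nyz : y != z by exact: adj_neq.
have n20 : x2 != x0 by rewrite neq_dist // d2 d0; apply/eqP; clear; lia.
have n2y : x2 != y by rewrite neq_dist // d2 dist_xx.
have n30 : x3 != x0 by rewrite neq_dist // d3 d0; apply/eqP; clear; lia.
have n3y : x3 != y by rewrite neq_dist // d3 dist_xx.
have n31 : x3 != x1 by rewrite neq_dist // d3 d1; apply/eqP; clear; lia.
have cf : config g x2 x3 x0 y x1 z.
  split=> //.
  - by rewrite /= !inE !negb_or n0y n01 n0z ny1 nyz n1z.
  - by rewrite power_adjE // d0 gE ltnn andbF.
  - by rewrite power_adjE // [_ <= g]leqNgt dz andbF.
  - move=> t; rewrite !inE => /or4P[]/eqP->; rewrite power_adjE //.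
    + by rewrite n20 dist_sym // (leq_trans d02).
    + by rewrite n2y d2 gE leqnSn.
    + by rewrite eq_sym (adj_neq a12) dist_sym // dist_adj.
    + apply/andP; split; first by apply: contraTneq dz => <-; rewrite dist_adj // gE.
      apply: leq_trans (dist_triangle conG y _ _) _.
      by rewrite d2 (dist_adj conG yz) addn1 gE.
  - by rewrite power_adjE // n30 dist_sym // (leq_trans d03).
  - by rewrite power_adjE // n3y d3 gE (leq_trans (leqnSn _)).
  - rewrite !inE !negb_or n30 n3y n31 /=.
    by apply: contraTneq dz => <-; rewrite -leqNgt (leq_trans d13).
have n2 : 1 < n.
  have := ball_leM x2.
  have : #|x2 |: [set x0; y; x1; z]| <= #|ball g x2|.
    apply/subset_leq_card; rewrite subUset sub1set ball_self //=; apply/subsetP => t.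
    by rewrite config_set => /(cfg_v cf); rewrite power_adjE // inE => /andP[].
  rewrite cardsU1 config_set (config_v cf).
  have -> : #|[set x0; y; x1; z]| = 4.
    have := card_uniqP (cfg_uniq cf) => /= <-; apply: eq_card => t.
    by rewrite config_set.
  move=> b1 b2; have := leq_trans b1 b2; by rewrite add1n !ltnS => /ltnW.
have [pc cw cv] := config_cost conG ball_leM n2 cf.
have far s t : s \in [:: x0; x1] -> t \in [:: y; z] -> 2 < dist s t.
  rewrite !inE => /orP[]/eqP-> /orP[]/eqP->.
  - by rewrite d0.
  - have := dist_triangle conG z x0 y; rewrite d0 dzy addn1 ltnS.
    exact: leq_trans.
  - by rewrite d1.
  - exact: ltn_trans dz.
have far' s t : s \in [:: x0; x1] -> t \in [:: y; z] -> 2 < dist t s.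
  by rewrite dist_sym //; apply: far.
(* Each precoloured vertex is near one other precoloured vertex only. *)
pose mate s := if s == x0 then x1 else if s == x1 then x0 else if s == y then z else y.
have mate1 : mate x1 = x0 by rewrite /mate eq_sym (negbTE n01) eqxx.
have matey : mate y = z by rewrite /mate eq_sym (negbTE n0y) (negbTE ny1) eqxx.
have matez : mate z = y.
  by rewrite /mate ![z == _]eq_sym (negbTE n0z) (negbTE n1z) (negbTE nyz).
have mateP s t : s \in [set x0; y; x1; z] -> t \in [set x0; y; x1; z] ->
    s != t -> dist s t <= 2 -> t = mate s /\ adj s t.
  rewrite !config_set => sS tS st; rewrite leqNgt => d.
  have [s1|s1] := boolP (s \in [:: x0; x1]).
    have t1 : t \in [:: x0; x1].
      move: tS d; rewrite !inE => /or4P[]/eqP->; rewrite ?eqxx ?orbT // far //.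
        by rewrite inE eqxx.
      by rewrite !inE eqxx orbT.
    move: s1 t1 st; rewrite !inE => /orP[]/eqP-> /orP[]/eqP->; rewrite ?eqxx // => _.
      by rewrite /mate eqxx.
    by rewrite mate1 adjC.
  have s2 : s \in [:: y; z].
    by move: sS s1; rewrite !inE => /or4P[]/eqP->; rewrite ?eqxx ?orbT.
  have t2 : t \in [:: y; z].
    move: tS d; rewrite !inE => /or4P[]/eqP->; rewrite ?eqxx ?orbT // far' //.
      by rewrite inE eqxx.
    by rewrite !inE eqxx orbT.
  move: s2 t2 st; rewrite !inE => /orP[]/eqP-> /orP[]/eqP->; rewrite ?eqxx // => _.
  by rewrite matez adjC.
rewrite -gE; apply: (finish_pow3 conG g_ge2 ball_leM g3 _ a23 _ _ pc _ _ cw cv).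
- by move=> x'; rewrite reg.
- by rewrite config_set (config_v cf).
- by rewrite config_set (cfg_w cf).
- by move=> s t sS tS st d; have [] := mateP s t sS tS st d.
- move=> s t t' sS tS tS' st st'.
  have [|-> _] := mateP s t sS tS (adj_neq st); first by rewrite dist_adj.
  by have [|-> _] := mateP s t' sS tS' (adj_neq st'); first by rewrite dist_adj.
Qed.

End Unambiguous.
End RegularPower.

(** * Unambiguous graphs of diameter g are Moore graphs *)

Section Moore.
Variable G : sgraph.
Hypothesis conG : forall x y : G, connect (@adj G) x y.
Variables (g D : nat).
Hypotheses (g_ge2 : 1 < g) (D_gt2 : 2 < D) (reg : regular G D).
Hypothesis noamb : forall x : G, ~ ambiguous g x.
Implicit Types (u v w x y z : G) (p q : seq G).

Lemma nbpath_inj v p q : nbpath v v p -> nbpath v v q ->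
  last v p = last v q -> size p <= g -> size q <= g -> p = q.
Proof.
move=> np nq l sp sq; apply/eqP/negPn/negP => /eqP npq.
by apply: (noamb (x := v)); exists p, q.
Qed.

Lemma nbpath_dist v p : nbpath v v p -> size p <= g -> dist v (last v p) = size p.
Proof.
move=> np sp; have dle : dist v (last v p) <= size p.
  by apply/(distP conG); exists p; split=> //; apply: nbpath_path np.
have /(dist_nbpath conG)[q [nq lq sq]] := leqnn (dist v (last v p)).
apply/eqP; rewrite eqn_leq dle /=.
by rewrite {1}(nbpath_inj np nq (esym lq) sp (leq_trans sq (leq_trans dle sp))).
Qed.

(** All vertices of a nonbacktracking walk of length at most g are distinct, as
    their distances from the start increase. *)
Lemma nbpath_levels v p : nbpath v v p -> size p <= g ->
  map (dist v) p = iota 1 (size p).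
Proof.
elim/last_ind: p => // p y IH np; rewrite size_rcons => sp.
have := np; rewrite nbpath_rcons => /and3P[np' _ _].
rewrite -[(size p).+1]addn1 iotaD -(IH np' (ltnW sp)) map_rcons -cats1; congr (_ ++ [:: _]).
by rewrite -[y in dist v y](last_rcons v p) nbpath_dist ?size_rcons // add1n.
Qed.

Lemma nbpath_uniq v p : nbpath v v p -> size p <= g -> uniq (v :: p).
Proof.
move=> np sp; apply: (@map_uniq _ _ (dist v)).
by rewrite map_cons (dist_xx conG) nbpath_levels //; exact: (iota_uniq 0 (size p).+1).
Qed.

Lemma nbpath_exists v k : exists2 p, nbpath v v p & size p = k.
Proof.
elim: k => [|k [p np sp]]; first by exists [::].
have : 0 < #|[set x | adj (last v p) x & x != last v (belast v p)]|.
  by rewrite card_next reg; case: adj; lia.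
case/card_gt0P => x; rewrite inE => /andP[ax nx].
by exists (rcons p x); rewrite ?size_rcons ?sp // nbpath_rcons np ax.
Qed.

(** Cut a cycle of length at most 2 g through x at a vertex y that is at most g
    steps away from x both ways round: its two halves contradict unambiguity. *)
Lemma no_short_cycle (c : seq G) : is_cycle c -> 2 * g < size c.
Proof.
case/andP; rewrite ltnNge => s2 /andP[]; case: c s2 => // x p s2 cyc up.
apply/negP => sg; move: s2 sg; rewrite /= -ltnNge !ltnS => p2 pg.
pose k := minn g.-1 (size p).-1.
have kp : k < size p by rewrite /k; lia.
move: cyc up; rewrite /= -(cat_take_drop k p) (drop_nth x kp).
have s1 : size (take k p) = k by rewrite size_take kp.
have s2 : size (drop k.+1 p) = size p - k.+1 by rewrite size_drop.
move: (take k p) (drop k.+1 p) (nth x p k) s1 s2 => p1 q y s1 s2.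
rewrite rcons_cat rcons_cons cat_path /= => /and3P[pp1 ly pq].
rewrite mem_cat inE !negb_or cat_uniq /= negb_or.
move=> /andP[/and3P[xp1 xy xq] /and3P[up1 /andP[yp1 disj] /andP[yq uq]]].
have nA : nbpath x x (rcons p1 y).
  apply: uniq_nbpath; first by rewrite rcons_path pp1.
  by rewrite -rcons_cons rcons_uniq /= inE negb_or eq_sym xy yp1 xp1.
have nB : nbpath x x (rcons (rev q) y).
  apply: uniq_nbpath; last first.
    by rewrite -rcons_cons rcons_uniq /= inE mem_rev negb_or eq_sym xy yq mem_rev xq rev_uniq.
  have := rev_path (@adj G) y (rcons q x).
  rewrite last_rcons belast_rcons rev_cons => ->.
  by under eq_path do rewrite adj_sym.
have E : rcons p1 y = rcons (rev q) y.
  apply: nbpath_inj nA nB _ _ _; rewrite ?last_rcons ?size_rcons ?size_rev //.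
    by rewrite s1 /k; lia.
  by rewrite s2 /k; lia.
have /rcons_inj[pq1] := E.
move: disj s1 s2 p2; rewrite pq1 -all_predC size_rev; case: (q) => [|z q'] /=.
  by rewrite /k => _ <- E2; move: kp; rewrite /k; lia.
by rewrite rev_cons mem_rcons inE eqxx.
Qed.

Hypothesis near : forall x y, dist x y <= g.

(** Start with a walk p of length g from v to y, leave y by a new edge to y' and
    return to v by a walk q. Unambiguity forces q to have length g, and p and q
    to have different first steps and no common vertex but v. *)
Lemma moore_cycle v : exists2 c : seq G, is_cycle c & size c = (2 * g).+1.
Proof.
have [p np sp] := nbpath_exists v g.
have pp := nbpath_path np.
have : 0 < #|[set x | adj (last v p) x & x != last v (belast v p)]|.
  by rewrite card_next reg; case: adj; lia.
case/card_gt0P => y'; rewrite inE; set y := last v p => /andP[ay' ny'].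
have [q [nq lq sq]] := dist_nbpath conG (near v y').
have pq := nbpath_path nq.
have penq : y != last v (belast v q).
  case/lastP: q nq lq sq {pq} => [|q x] nq lq sq.
    rewrite /= /y; apply/eqP => E; move: (nbpath_dist np); rewrite sp E dist_xx // => H.
    by move: g_ge2; rewrite -H.
  rewrite belast_rcons /=; apply/eqP => E; move: nq sq.
  rewrite nbpath_rcons size_rcons => /and3P[nq _ _] sq.
  have /(congr1 size) := nbpath_inj np nq E (eq_leq sp) (ltnW sq).
  by rewrite sp => E'; rewrite -E' ltnn in sq.
have nqy : nbpath v v (rcons q y) by rewrite nbpath_rcons nq lq adjC ay' penq.
have {}sq : size q = g.
  apply/eqP; rewrite eqn_leq sq leqNgt; apply/negP => sq'.
  have E : p = rcons q y.
    by apply: nbpath_inj np nqy _ _ _; rewrite ?last_rcons ?size_rcons ?sp.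
  by move: ny'; rewrite E belast_rcons /= lq eqxx.
have hd : head v p != head v q.
  have yE : last v p = y by [].
  apply/eqP; case: (p) (np) (sp) yE => [|a p1] np1 sp1 E.
    by move: g_ge2; rewrite -sp1.
  case: (q) nqy sq => [|b q1] nqy sq; first by move: g_ge2; rewrite -sq.
  rewrite /= => ab; subst b; apply: (noamb (x := a)); exists p1, (rcons q1 y).
  move: np1 nqy sp1 sq => /= /and3P[_ _ n1] /and3P[_ _ n2] s1 s2.
  split.
  - by split; apply: nbpath_weak; eassumption.
  - by move=> /(congr1 size); rewrite size_rcons; move: s1; rewrite -s2 => -[->] /n_Sn.
  - by rewrite last_rcons -E.
  - by rewrite -s1.
  - by rewrite size_rcons s2.
exists (v :: p ++ rev q); last by rewrite /= size_cat size_rev sp sq addnn mul2n.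
rewrite /is_cycle /= size_cat size_rev sp sq; apply/andP; split; first by move: g_ge2; lia.
rewrite /ucycleb /=; apply/andP; split.
  rewrite rcons_cat cat_path pp /= -rev_cons (lastI v q) rev_rcons lq /= ay' /=.
  by rewrite -lq rev_path; under eq_path do rewrite adj_sym.
have /= /andP[vp up] := nbpath_uniq np (eq_leq sp).
have /= /andP[vq uq] := nbpath_uniq nq (eq_leq sq).
rewrite mem_cat mem_rev negb_or vp vq cat_uniq up rev_uniq uq andbT /=.
rewrite andbT; apply/hasPn => z; rewrite mem_rev => zq; apply/negP => /= zp.
move: hd; have [p1 [p2 pE]] : exists p1 p2, p = rcons p1 z ++ p2.
  by case/splitPr: zp => p1 p2; exists p1, p2; rewrite cat_rcons.
have [q1 [q2 qE]] : exists q1 q2, q = rcons q1 z ++ q2.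
  by case/splitPr: zq => q1 q2; exists q1, q2; rewrite cat_rcons.
move: np nq sp sq; rewrite pE qE !nbpath_cat !size_cat => /andP[np1 _] /andP[nq1 _] sp sq.
have -> : rcons p1 z = rcons q1 z.
  apply: nbpath_inj np1 nq1 _ _ _; rewrite ?last_rcons //.
    by rewrite -sp leq_addr.
  by rewrite -sq leq_addr.
by case: q1 {qE nq1 sq} => [|b q1] /=; rewrite eqxx.
Qed.

Lemma unambiguous_is_moore : 0 < #|G| -> is_moore_graph G D g.
Proof.
move=> G0; have /card_gt0P[v _] := G0.
have full : ball g v = setT by apply/setP => y; rewrite !inE near.
split=> //.
- rewrite -cardsT -full; apply/eqP; rewrite eqn_leq card_ball_le //=; last 2 first.
    by move=> x; rewrite reg.
    exact: ltnW.
  rewrite ltnNge; apply/negP => /(ambiguousP conG D_gt2 reg v (ltnW g_ge2)); exact: noamb.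
- split; first exact: moore_cycle v.
  exact: no_short_cycle.
apply/eqP; rewrite eqn_leq; apply/andP; split.
  by apply/bigmax_leqP => x _; apply/bigmax_leqP => y _; apply: near.
have [p np sp] := nbpath_exists v g.
have d : dist v (last v p) = g by rewrite nbpath_dist ?sp.
rewrite -[leqLHS]d /diameter.
apply: (bigmax_sup v) => //; exact: (bigmax_sup (last v p)).
Qed.

End Moore.

(** * Cuts and identifications *)

Lemma card_bigcup_le (I T : finType) (A : {set I}) (F : I -> {set T}) :
  #|\bigcup_(i in A) F i| <= \sum_(i in A) #|F i|.
Proof.
elim/big_rec2: _ => [|i m X _ IH]; first by rewrite cards0.
by apply: leq_trans (leq_card_setU _ _) _; rewrite leq_add2l.
Qed.

Lemma card_bigcup_const (I T : finType) (A : {set I}) (F : I -> {set T}) k :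
  {in A, forall i, #|F i| <= k} -> #|\bigcup_(i in A) F i| <= #|A| * k.
Proof.
move=> Fk; apply: leq_trans (card_bigcup_le _ _) _.
by rewrite -sum_nat_const; apply: leq_sum.
Qed.

Section Cut.
Variables (T : finType) (e : rel T) (n : nat).
Hypothesis e_sym : symmetric e.

(** The colours of one side of the cut are shifted cyclically. Every edge of e
    across the cut forbids one shift, so with fewer edges than colours some shift
    is left. *)
Lemma shift_colouring (A : {set T}) (c1 c2 : T -> 'I_n) :
  proper_on e A c1 -> proper_on e (~: A) c2 ->
  #|[set xy : T * T | [&& xy.1 \in A, xy.2 \notin A & e xy.1 xy.2]]| < n ->
  exists c : T -> 'I_n, proper_on e setT c.
Proof.
case: n c1 c2 => // m c1 c2 p1 p2 few.
set C := [set _ | _] in few.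
pose bad := [set (c1 xy.1 - c2 xy.2)%R | xy in C].
have [t tP] : exists t, t \notin bad.
  apply/existsP; rewrite -negb_forall; apply/negP => /forallP all_in.
  have : m.+1 <= #|bad|.
    rewrite -[leqLHS]card_ord; apply/subset_leq_card/subsetP => k _; exact: all_in.
  by rewrite leqNgt (leq_ltn_trans (leq_imset_card _ _) few).
pose c x := if x \in A then c1 x else (c2 x + t)%R.
have cross x y : x \in A -> y \notin A -> e x y -> c x != c y.
  move=> xA yA xy; rewrite /c xA (negbTE yA); apply: contraNneq tP => E.
  apply/imsetP; exists (x, y); first by rewrite inE /= xA yA.
  by rewrite /= E GRing.addrC GRing.addKr.
exists c => x y _ _ xy; have [xA|xA] := boolP (x \in A); have [yA|yA] := boolP (y \in A).
- by rewrite /c xA yA; apply: p1.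
- exact: cross.
- by rewrite eq_sym; apply: cross => //; rewrite e_sym.
- rewrite /c (negbTE xA) (negbTE yA); apply: contra_neq (p2 x y _ _ xy); rewrite ?inE //.
  exact: GRing.addIr.
Qed.

Lemma merge_colouring (f : T -> T) : (forall x y, e x y -> f x != f y) ->
  #|f @: setT| <= n -> exists c : T -> 'I_n, proper_on e setT c.
Proof.
move=> fP fn; case: (pickP (mem (f @: setT))) => [z zA|no]; last first.
  have abs (x : T) : False by have := no (f x); rewrite /= imset_f ?inE.
  by exists (fun x => match abs x with end) => x; case: (abs x).
have fA x : f x \in f @: setT by rewrite imset_f ?inE.
exists (fun x => widen_ord fn (enum_rank_in zA (f x))) => x y _ _ /fP.
apply: contra_neq => /(congr1 val) /= /val_inj E.
exact: (enum_rank_in_inj (fA x) (fA y) E).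
Qed.

(** The map f sends one element of each of m disjoint non-adjacent pairs to the
    other one, and X contains these pairs; colouring by the values of f saves m
    colours. *)
Definition mergeable m (X : {set T}) := exists f : T -> T,
  [/\ forall x y, e x y -> f x != f y, #|f @: setT| + m <= #|T|, #|X| <= 2 * m,
      forall x, x \notin X -> f x = x & forall x, x \in X -> f x \in X].

Hypothesis e_irr : irreflexive e.

Lemma mergeable0 : mergeable 0 set0.
Proof.
exists id; split; rewrite ?cards0 ?addn0 ?max_card //.
by move=> x y; apply: contraTneq => ->; rewrite e_irr.
Qed.

Lemma mergeableS m X a b : mergeable m X -> a \notin X -> b \notin X ->
  a != b -> ~~ e a b -> mergeable m.+1 (a |: (b |: X)).
Proof.
case=> f [fe fc Xc fX fXX] aX bX ab nab.
pose f' x := if x == b then a else f x.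
have fb x : x != b -> f x != b.
  move=> xb; have [xX|xX] := boolP (x \in X); last by rewrite fX.
  by apply: contraNneq bX => <-; apply: fXX.
have fa x : e b x -> f x != a.
  move=> bx; have [xX|xX] := boolP (x \in X).
    by apply: contraNneq aX => <-; apply: fXX.
  by rewrite fX //; apply: contraNneq nab => <-; rewrite e_sym.
exists f'; split.
- move=> x y xy; rewrite /f'; case: (eqVneq x b) => [xb|xb]; case: (eqVneq y b) => [yb|yb].
  + by rewrite xb yb e_irr in xy.
  + by rewrite eq_sym fa // -xb.
  + by rewrite fa // -yb e_sym.
  + exact: fe.
- apply: leq_trans fc; rewrite addnS -addSn leq_add2r.
  rewrite (cardsD1 b (f @: setT)) -{1}(fX b bX) imset_f ?inE // add1n ltnS.
  apply/subset_leq_card/subsetP => _ /imsetP[x _ ->]; rewrite !inE /f'.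
  case: (eqVneq x b) => [_|xb]; first by rewrite ab -(fX a aX) imset_f ?inE.
  by rewrite fb // imset_f ?inE.
- by rewrite !cardsU1; do 2!case: (_ \notin _); lia.
- move=> x; rewrite !inE !negb_or => /and3P[xa xb xX].
  by rewrite /f' (negbTE xb) fX.
move=> x; rewrite !inE /f' => xP; case: (eqVneq x b) xP => [_|xb] /=; first by rewrite eqxx.
case/orP => [/eqP->|xX]; first by rewrite fX // eqxx.
by rewrite fXX ?orbT.
Qed.

Lemma mergeable_colouring m X : mergeable m X -> #|T| <= n + m ->
  exists c : T -> 'I_n, proper_on e setT c.
Proof.
case=> f [fe fc _ _ _] Tn; apply: merge_colouring fe _.
by rewrite -(leq_add2r m) (leq_trans fc).
Qed.

End Cut.

Section Side.
Variable G : sgraph.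
Hypothesis conG : forall x y : G, connect (@adj G) x y.
Variables (g n : nat).
Hypothesis g_ge2 : 1 < g.
Hypothesis ball_le : forall x : G, #|ball g x| <= n.+2.
Hypothesis n_gt0 : 0 < n.
Local Notation e := (power_adj G g).
Implicit Types (u v w x y z : G) (A : {set G}).

(** One side of a cut needs no savings: colour its vertices by decreasing distance
    to the other side, which stays uncoloured. A vertex next to the other side
    sees two vertices there, as these are not isolated on their side. *)
Lemma colour_side A : A != setT ->
  (forall x, x \notin A -> exists2 y, adj x y & y \notin A) ->
  exists c : G -> 'I_n, proper_on e A c.
Proof.
move=> AT nb; have [b0 b0A] : exists b, b \notin A.
  by apply/existsP; rewrite -negb_forall; apply: contraNN AT => /forallP AT;
     apply/eqP/setP => x; rewrite inE AT.
pose b u := [arg min_(b < b0 | b \notin A) dist u b].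
pose rk u := dist u (b u).
have bA u : b u \notin A by rewrite /b; case: arg_minnP.
have rk_le u y : y \notin A -> rk u <= dist u y.
  by move=> yA; rewrite /rk /b; case: arg_minnP => // z _; apply.
have eS := @power_adj_sym G g; have eI := @power_adj_irrefl G g.
have nbh_le u : #|nbh e u| <= n.+1.
  by rewrite card_nbh_power // -ltnS prednK //; apply/card_gt0P; exists u; rewrite ball_self.
have dis0 : [disjoint A & set0] by rewrite disjoint_sym disjoints_subset sub0set.
have [||c pc _] := @greedy_colouring2 _ e n eS eI nbh_le A set0 rk (fun=> Ordinal n_gt0) dis0.
- by move=> x y; rewrite inE.
- move=> u uA; case d: (dist u (b u)) => [|j].
    by move/eqP: d; rewrite dist_eq0 // => /eqP E; have := bA u; rewrite -E uA.
  have [u1 uu1 d1] := dist_next conG d.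
  have fin u2 : adj u1 u2 -> (u2 \notin A \/ dist u2 (b u) < dist u (b u)) ->
      exists t1 t2, [/\ t1 != t2, e u t1, e u t2 &
      {in [:: t1; t2], forall t, t \notin set0 /\ (t \in A -> rk t < rk u)}].
    move=> u12 u2P; exists u1, u2; split.
    - exact: adj_neq.
    - by apply: (power_adj_le conG (adj_neq uu1) _ (ltnW g_ge2)); rewrite dist_adj.
    - apply: (power_adj_le conG _ (dist2 conG uu1 u12) g_ge2).
      by case: u2P => [|h]; [apply: contraNneq => <- | apply: contraTneq h => <-; rewrite ltnn].
    - move=> t tP; rewrite inE; split=> // tA; rewrite /rk -/(rk t).
      apply: leq_ltn_trans (rk_le t _ (bA u)) _.
      move: tP tA; rewrite !inE => /orP[]/eqP-> tA; first by rewrite d1 d.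
      by case: u2P => //; rewrite tA.
  case: j d d1 => [|j] d d1.
    move/eqP: d1; rewrite dist_eq0 // => /eqP E.
    have u1A : u1 \notin A by rewrite E.
    have [u2 u12 u2A] := nb u1 u1A.
    by apply: (fin u2) => //; left.
  have [u2 u12 d2] := dist_next conG d1.
  by apply: (fin u2) => //; right; rewrite d2 d ltnW.
by exists c; rewrite setU0 in pc.
Qed.

Lemma colour_cut A : A != set0 -> A != setT ->
  (forall x, exists2 y, adj x y & (y \in A) = (x \in A)) ->
  #|[set xy : G * G | [&& xy.1 \in A, xy.2 \notin A & e xy.1 xy.2]]| < n ->
  colourable G g n.
Proof.
move=> A0 AT nb few.
have [|c1 p1] := @colour_side A AT.
  by move=> x xA; have [y xy yA] := nb x; exists y; rewrite // yA.
have [||c2 p2] := @colour_side (~: A).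
- by apply: contraNneq A0 => E; rewrite -(setCK A) E setCT.
- by move=> x; rewrite inE negbK => xA; have [y xy yA] := nb x; exists y; rewrite ?inE ?yA ?negbK.
exact: (shift_colouring (@power_adj_sym G g) p1 p2 few).
Qed.
End Side.

(** * Squares *)

Lemma moore_bound2 D : 2 < D -> moore_bound D 2 = D * D.
Proof.
move=> D2; rewrite moore_boundE // !geoS geo0 muln0 addn0 muln1.
by rewrite subn1 add1n prednK // (ltn_trans _ D2).
Qed.

Section Square.
Variable G : sgraph.
Hypothesis conG : forall x y : G, connect (@adj G) x y.
Variables (n D : nat).
(* All that matters about 1000 is that D ^ 2 exceeds the linear bounds in D. *)
Hypotheses (D_large : 1000 <= D) (reg : regular G D).
Hypothesis Dn : D * D = n.+1.
Hypothesis ball_ge : forall x : G, n.+1 <= #|ball 2 x|.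
Local Notation e := (power_adj G 2).
Local Notation B := (ball 2).
Local Notation N x := [set y | adj x y].
Implicit Types (u v w x y z : G) (K X Y S : {set G}).

Let g2 : 1 < 2 := isT.
Let D_gt2 : 2 < D. Proof. exact: leq_trans D_large. Qed.

Let Mn : moore_bound D 2 = n.+1. Proof. by rewrite moore_bound2. Qed.

Let ball_le x : #|B x| <= n.+2.
Proof. exact: (ball_leM conG g2 D_gt2 reg Mn). Qed.

Let n_gt0 : 0 < n.
Proof. by rewrite -ltnS -Dn; move: D_large; clear; nia. Qed.

Lemma card_N x : #|N x| = D. Proof. exact: reg. Qed.

Lemma in_ball2 x y : reflect (x = y \/ adj x y \/ exists2 z, adj x z & adj z y) (y \in B x).
Proof.
rewrite inE; apply: (iffP (dist_leS conG _ _ _)) => [[->|[z xz]]|[->|[xy|[z xz zy]]]].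
- by left.
- rewrite leq_eqVlt ltnS leqn0 dist_eq0 // dist_eq1 // => /orP[zy|/eqP<-].
    by right; right; exists z.
  by right; left.
- by left.
- by right; exists y; rewrite ?dist_xx.
- by right; exists z; rewrite ?dist_adj.
Qed.

Lemma powerE x y : e x y = (x != y) && (y \in B x).
Proof. by rewrite power_adjE // inE. Qed.

(** Each common neighbour of x and y after the first one makes the ball of x
    smaller by one, and at most one vertex may be missing there. *)
Lemma codegree_le2 x y : x != y -> #|N x :&: N y| <= 2.
Proof.
move=> xy.
have sub : B x \subset [set x; y] :|: N x :|: \bigcup_(z in N x) (N z :\ x :\ y).
  apply/subsetP => t /in_ball2[->|[xt|[z xz zt]]]; rewrite !inE ?eqxx ?xt ?orbT //.
  have [->|tx] := eqVneq t x; first by [].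
  have [->|ty] := eqVneq t y; first by rewrite orbT.
  by apply/orP; right; apply/bigcupP; exists z; rewrite !inE ?xz // ty tx.
have cz z : z \in N x -> #|N z :\ x :\ y| = D - 1 - (z \in N y).
  rewrite inE => xz; have := card_N z.
  rewrite (cardsD1 x) inE adjC xz => <-; rewrite add1n subn1 /=.
  rewrite [X in _ = X - _](cardsD1 y) !inE (eq_sym y) xy /= (adjC z y).
  by case: (adj y z); rewrite ?add1n ?subn1 ?subn0.
have sum : \sum_(z in N x) #|N z :\ x :\ y| + #|N x :&: N y| <= D * (D - 1).
  rewrite -sum1_card (big_setID (N y)) /=.
  rewrite addnAC -big_split /= -{1}(card_N x) -sum_nat_const [leqRHS](big_setID (N y)) /=.
  apply: leq_add; apply: leq_sum => z; rewrite ?in_setI ?in_setD.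
    by move=> /andP[zx zy]; rewrite cz // zy; move: D_gt2; clear; lia.
  by move=> /andP[zy zx]; rewrite cz // leq_subr.
have := leq_trans (ball_ge x) (subset_leq_card sub).
move/leq_trans => /(_ _ (leq_card_setU _ _)).
have c1 : #|[set x; y] :|: N x| <= 2 + D.
  by apply: leq_trans (leq_card_setU _ _) _; rewrite card_N cards2 xy.
have c2 := card_bigcup_le (N x) (fun z => N z :\ x :\ y).
move: c1 c2 sum Dn D_gt2; clear.
move: #|_ :|: _| #|\bigcup_(_ in _) _| (\sum_(_ in _) _) #|_ :&: _| => a b s c.
nia.
Qed.

(** If G has order n + j then j disjoint non-adjacent pairs suffice. For order
    n + 2, a non-adjacent pair a, b makes a ambiguous; so a has an ambiguous
    neighbour w, and this lies in a second pair, because b misses only one vertex.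
    For larger orders every vertex lies in a pair, and as no vertex lies in more
    than 11 of them, disjoint pairs can be chosen greedily. *)
Lemma colourable_small_order a b : a != b -> ~~ e a b -> #|G| <= n + 12 ->
  colourable G 2 n.
Proof.
move=> ab nab small.
have eS := @power_adj_sym G 2; have eI := @power_adj_irrefl G 2.
have out x y : x != y -> ~~ e x y -> y \notin B x.
  by move=> xy; rewrite powerE xy.
have bB : b \notin B a by apply: out.
have n_lt : n.+1 < #|G|.
  apply: leq_ltn_trans (ball_ge a) _.
  by rewrite -cardsT; apply/proper_card/properP; split; [exact: subsetT | exists b].
have exout x : #|B x| < #|G| -> exists2 y, y \notin B x & x != y.
  move=> lt; have : 0 < #|~: B x| by rewrite -subn_gt0 in lt; rewrite cardsCs setCK.
  case/card_gt0P => y; rewrite inE => yB; exists y => //.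
  by apply: contraNneq yB => <-; apply: ball_self.
have noe x y : y \notin B x -> ~~ e x y by rewrite powerE negb_and => ->; rewrite orbT.
move: (n_lt); rewrite leq_eqVlt => /orP[/eqP oG|big].
  have aamb : ambiguous 2 a.
    apply/(ambP conG g2 D_gt2 reg Mn); rewrite -ltnS oG -cardsT.
    by apply/proper_card/properP; split; [exact: subsetT | exists b].
  have [w aw wamb] := ambiguous_nbr g2 aamb.
  have [w' w'B ww'] : exists2 y, y \notin B w & w != y.
    by apply: exout; rewrite -oG ltnS; apply/(ambP conG g2 D_gt2 reg Mn).
  have wa : w \in B a by apply/in_ball2; right; left.
  have wb : w != b by apply: contraNneq bB => <-.
  have aw' : a != w' by apply: contraNneq w'B => <-; rewrite ball_sym.
  have bw' : b != w'.
    apply/eqP => E; subst w'.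
    have : a |: (w |: B b) \subset setT by exact: subsetT.
    move/subset_leq_card; rewrite !cardsU1.
    have -> : (a \in w |: B b) = false.
      by rewrite in_setU1 (negbTE (adj_neq aw)) ball_sym // (negbTE bB).
    have -> : (w \in B b) = false by rewrite ball_sym // (negbTE w'B).
    by rewrite cardsT -oG /= !add1n !ltnS leqNgt ball_ge.
  have m1 := mergeableS eS eI (mergeable0 eI) (negbT (in_set0 a)) (negbT (in_set0 b)) ab nab.
  have wX : w \notin a |: (b |: set0).
    by rewrite !inE orbF negb_or wb eq_sym (adj_neq aw).
  have w'X : w' \notin a |: (b |: set0).
    by rewrite !inE orbF negb_or !(eq_sym w') bw' aw'.
  have m2 := mergeableS eS eI m1 wX w'X ww' (noe _ _ w'B).
  by apply: (mergeable_colouring m2); rewrite -oG addn2.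
have cB x : #|~: B x| <= 11.
  have := cardsC (B x); have := ball_ge x; move: small; clear; lia.
have step m X : mergeable e m X -> m <= 12 -> exists Y, mergeable e m.+1 Y.
  move=> mX m12; have Xc : #|X| <= 2 * m by case: mX => f [].
  have : 0 < #|~: (X :|: \bigcup_(x in X) ~: B x)|.
    have c1 := @card_bigcup_const _ _ X (fun x => ~: B x) 11 (fun x _ => cB x).
    have c2 := leq_card_setU X (\bigcup_(x in X) ~: B x).
    have c3 := cardsC (X :|: \bigcup_(x in X) ~: B x).
    have arith c d f k l : c <= k * 11 -> d <= k + c -> d + f = l -> k <= 2 * m ->
        n.+1 < l -> 0 < f.
      by move: m12 D_large Dn; clear; nia.
    exact: arith c1 c2 c3 Xc n_lt.
  case/card_gt0P => x; rewrite !inE negb_or => /andP[xX xU].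
  have [y yB xy] := exout x (leq_ltn_trans (ball_le x) big).
  have yX : y \notin X.
    apply: contraNN xU => yX; apply/bigcupP; exists y => //.
    by rewrite inE ball_sym.
  by exists (x |: (y |: X)); exact: (mergeableS eS eI mX xX yX xy (noe _ _ yB)).
have all m : m <= 13 -> exists X, mergeable e m X.
  elim: m => [|m IH] m13; first by exists set0; exact: (mergeable0 eI).
  by have [X mX] := IH (ltnW m13); apply: step mX _.
have [X mX] := all 13 (leqnn _).
by apply: (mergeable_colouring mX); rewrite (leq_trans small) // leq_add2l.
Qed.

(** A vertex of K has at most 10 neighbours in the square outside K. Let T be the
    set of vertices outside K next to K. A vertex of T sees almost all of K, so
    double counting bounds T by 10, and in G it has at most 10 neighbours outside K.
    Hence either K and T are everything and the order is small, or at most 100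
    edges leave the union of K and T. The colours of the two sides can then be
    shifted apart, because an edge of the cut causes at most 2 D + 1 conflicts. *)
Lemma colourable_near_clique a b K : a != b -> ~~ e a b ->
  {in K &, forall x y, x != y -> e x y} -> n.+1 <= #|K| + 9 ->
  colourable G 2 n.
Proof.
move=> ab nab cl bigK.
have D2 : D * D = n.+1 by [].
have KB x : x \in K -> K \subset B x.
  move=> xK; apply/subsetP => y yK; have [<-|xy] := eqVneq x y; first exact: ball_self.
  by have := cl x y xK yK xy; rewrite powerE => /andP[].
have out x : x \in K -> #|B x :\: K| <= 10.
  move=> xK; have := cardsID K (B x); have := subset_leq_card (KB x xK).
  rewrite (setIidPr (KB x xK)); have := ball_le x; move: bigK; clear; lia.
pose T := [set t in ~: K | [exists x in K, adj x t]].
have TP t : reflect (t \notin K /\ exists2 x, x \in K & adj x t) (t \in T).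
  rewrite !inE; apply: (iffP andP) => -[tK].
    by case/exists_inP => x xK xt; split=> //; exists x.
  by case=> x xK xt; split=> //; apply/exists_inP; exists x.
have NB x : N x \subset B x.
  by apply/subsetP => y; rewrite inE => xy; apply/in_ball2; right; left.
have outN x : x \in K -> #|N x :\: K| <= 10.
  by move=> xK; apply: leq_trans (out x xK); apply/subset_leq_card/setSD/NB.
have outT t : t \in T -> #|N t :\: K| <= 10.
  case/TP => tK [x xK xt]; apply: leq_trans (out x xK); apply/subset_leq_card/setSD.
  apply/subsetP => y; rewrite inE => ty; apply/in_ball2; right; right; by exists t.
have BT t : t \in T -> n.+1 <= #|K :&: B t| + (11 + 20 * D).
  move=> tT; apply: leq_trans (ball_ge t) _.
  rewrite -(cardsID K (B t)) setIC leq_add2l.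
  have sub : B t :\: K \subset t |: (N t :\: K)
      :|: (\bigcup_(x in N t :&: K) (N x :\: K) :|: \bigcup_(x in N t :\: K) N x).
    apply/subsetP => y; rewrite in_setD => /andP[yK /in_ball2[->|[ty|[z tz zy]]]].
    - by rewrite !inE eqxx.
    - by rewrite !inE ty yK orbT.
    rewrite !in_setU; apply/orP; right; apply/orP; have [zK|zK] := boolP (z \in K).
      by left; apply/bigcupP; exists z; rewrite !inE ?tz ?yK.
    by right; apply/bigcupP; exists z; rewrite !inE ?tz ?zK.
  apply: leq_trans (subset_leq_card sub) _.
  apply: leq_trans (leq_card_setU _ _) _.
  have c1 : #|t |: (N t :\: K)| <= 11.
    rewrite cardsU1 -(add1n 10) leq_add ?outT //; by case: (_ \notin _).
  have c2 : #|\bigcup_(x in N t :&: K) (N x :\: K)| <= D * 10.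
    apply: leq_trans (card_bigcup_const (k := 10) _) _.
      by move=> x; rewrite inE => /andP[_ /outN].
    by rewrite leq_mul2r -(card_N t) subset_leq_card ?orbT // subsetIl.
  have c3 : #|\bigcup_(x in N t :\: K) N x| <= 10 * D.
    apply: leq_trans (card_bigcup_const (k := D) _) _.
      by move=> x _; rewrite card_N.
    by rewrite leq_mul2r outT ?orbT.
  apply: leq_trans (leq_add c1 (leq_trans (leq_card_setU _ _) (leq_add c2 c3))) _.
  by clear; lia.
have cardK : #|K| <= n.+2.
  have [->|[x xK]] := set_0Vmem K; first by rewrite cards0.
  exact: leq_trans (subset_leq_card (KB x xK)) (ball_le x).
have cT : #|T| <= 10.
  have dbl : \sum_(t in T) #|K :&: B t| <= #|K| * 10.
    have -> : \sum_(t in T) #|K :&: B t| = \sum_(t in T) \sum_(x in K) (x \in B t).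
      apply: eq_bigr => t _; rewrite -sum1_card big_mkcond [RHS]big_mkcond /=.
      by apply: eq_bigr => x _; rewrite in_setI; do 2!case: (_ \in _).
    rewrite exchange_big /= -sum_nat_const; apply: leq_sum => x xK.
    apply: leq_trans (out x xK); rewrite -sum1_card big_mkcond [leqRHS]big_mkcond /=.
    apply: leq_sum => t _; case: ifP => // /TP[tK _].
    by rewrite ball_sym // in_setD tK /=; case: (_ \in _).
  have low : #|T| * (n.+1 - (11 + 20 * D)) <= \sum_(t in T) #|K :&: B t|.
    by rewrite -sum_nat_const; apply: leq_sum => t /BT; rewrite leq_subLR addnC.
  have arith c k : c * (n.+1 - (11 + 20 * D)) <= k * 10 -> k <= n.+2 -> c <= 10.
    move: D_large Dn; clear => D0 Dn ck kn.
    have H1 : 11 * (n.+1 - (11 + 20 * D)) > n.+2 * 10 by nia.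
    by nia.
  exact: arith (leq_trans low dbl) cardK.
pose A := K :|: T.
have K0 : K != set0.
  by apply/eqP => E; move: bigK; rewrite E cards0; move: D_large Dn; clear; nia.
have [AT|AT] := eqVneq A setT.
  apply: (colourable_small_order ab nab).
  rewrite -cardsT -AT; apply: leq_trans (leq_card_setU _ _) _.
  by move: cT cardK; clear; lia.
have NA x y : x \in K -> adj x y -> y \in A.
  move=> xK xy; rewrite in_setU; have [//|yK] := boolP (y \in K).
  by apply/TP; split=> //; exists x.
apply: (colour_cut conG g2 ball_le n_gt0 _ AT).
- by apply: contraNneq K0 => E; rewrite -subset0 -E subsetUl.
- move=> x; have [xK|xK] := boolP (x \in K).
    have : 0 < #|N x :&: K|.
      have := cardsID K (N x); have := outN x xK; rewrite card_N; move: D_large; clear; lia.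
    case/card_gt0P => y; rewrite !inE => /andP[xy yK].
    by exists y => //; rewrite !in_setU yK xK.
  have [xT|xT] := boolP (x \in T).
    have /TP[_ [y yK yx]] := xT.
    by exists y; rewrite 1?adjC // !in_setU yK xT orbT.
  have xA : x \notin A by rewrite in_setU negb_or xK.
  have : 0 < #|N x :\: T|.
    have := cardsID T (N x); have := subset_leq_card (subsetIr (N x) T).
    rewrite card_N; move: cT D_large; clear; lia.
  case/card_gt0P => y; rewrite in_setD => /andP[yT']; rewrite inE => xy.
  exists y => //; rewrite -/A (negbTE xA); apply/negbTE.
  rewrite in_setU negb_or yT' andbT.
  by apply: contra xA => yK; apply: (NA y); rewrite // adjC.
(* Every conflict across the cut uses one of its at most 100 edges E. *)
pose F tb := setX (tb.1 |: N tb.1) [set tb.2] :|: setX [set tb.1] (N tb.2) : {set G * G}.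
pose E := \bigcup_(t in T) setX [set t] (N t :\: K).
have cE : #|E| <= 100.
  apply: leq_trans (card_bigcup_const (k := 10) _) _.
    by move=> t tT; rewrite cardsX cards1 mul1n outT.
  by rewrite -[100]/(10 * 10) leq_mul2r cT.
have cF : #|\bigcup_(tb in E) F tb| <= 100 * (D.+1 + D).
  apply: leq_trans (card_bigcup_const (k := D.+1 + D) _) _.
    move=> tb _; apply: leq_trans (leq_card_setU _ _) _.
    rewrite !cardsX !cards1 muln1 mul1n card_N leq_add2r cardsU1 card_N.
    by case: (_ \notin _).
  by rewrite leq_mul2r cE orbT.
have lt : 100 * (D.+1 + D) < n by move: D_large Dn; clear; nia.
apply: leq_ltn_trans lt; apply: leq_trans cF; apply/subset_leq_card/subsetP => -[p q].
rewrite inE /= powerE => /and3P[pA qA /andP[pq /in_ball2 pqB]].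
have inEd t y : t \in A -> y \notin A -> adj t y -> (t, y) \in E /\ t \in T.
  move=> tA yA ty; have tT : t \in T.
    move: tA; rewrite in_setU => /orP[tK|//].
    by move: yA; rewrite (NA t y tK ty).
  split=> //; apply/bigcupP; exists t => //; rewrite !inE eqxx ty andbT /=.
  by apply: contra yA; rewrite in_setU => ->.
case: pqB => [pq'|[pq'|[m pm mq]]]; first by rewrite pq' eqxx in pq.
  have [inEd' _] := inEd p q pA qA pq'.
  by apply/bigcupP; exists (p, q) => //; rewrite !inE /= !eqxx.
have [mA|mA] := boolP (m \in A).
  have [inEd' _] := inEd m q mA qA mq.
  by apply/bigcupP; exists (m, q) => //; rewrite !inE /= eqxx adjC pm orbT.
have [inEd' _] := inEd p m pA mA pm.
by apply/bigcupP; exists (p, m) => //; rewrite !inE /= eqxx mq orbT.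
Qed.

Section NoNearClique.
(* The 9 is what finding two pairs costs: 4 boundary vertices, v, y, and then the
   first pair with w are removed from a ball of order at least n + 1. *)
Hypothesis spread : forall X, n.+1 <= #|X| + 9 ->
  exists a b, [/\ a \in X, b \in X, a != b & ~~ e a b].

Lemma avoid_sym S : connect_sym (@avoid G S).
Proof.
apply: sym_connect_sym => x y; rewrite /= adj_sym.
by case: (x \in S); rewrite ?andbF ?andbT.
Qed.

(** A neighbour w of v that sees both elements of some pair at distance 3 in the
    ball of v. If a is adjacent to v, then the middle vertex between v and b
    serves. Otherwise the middle vertex p between v and a either sees b or forms
    itself a pair with b, and likewise on the side of b. The vertex y has to be
    kept out of the pair; it can be the middle vertex on both sides only if it
    sees a and b. *)
Lemma seen_pair v y a b : a \in B v -> b \in B v -> a != v -> b != v ->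
  a != y -> b != y -> a != b -> ~~ e a b ->
  exists p q w, [/\ adj v w, [/\ p != q & ~~ e p q], e v p /\ e v q, e w p /\ e w q &
    {in [:: p; q], forall x, x != y /\ (x \in [:: a; b] \/ adj v x)}].
Proof.
move=> aB bB av bv ay by_ ab nab.
have eB x : x \in B v -> x != v -> e v x by move=> xB xv; rewrite powerE eq_sym xv.
have eadj x z : adj x z -> e x z.
  by move=> xz; rewrite powerE (adj_neq xz); apply/in_ball2; right; left.
have e2 x m z : adj x m -> adj m z -> x != z -> e x z.
  by move=> xm mz xz; rewrite powerE xz; apply/in_ball2; right; right; exists m.
have aux p q : adj v p -> e v q -> p != q -> ~~ e p q ->
    exists2 w, adj v w & e w p /\ e w q.
  move=> vp vq pq npq; move: vq; rewrite powerE => /andP[vq /in_ball2[vE|[vq'|[w vw wq]]]].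
  - by rewrite vE eqxx in vq.
  - by case/negP: npq; apply: (e2 _ v); rewrite // adjC.
  exists w => //; split; last exact: eadj.
  apply: (e2 _ v); rewrite // 1?adjC //.
  by apply: contraNneq npq => <-; apply: eadj.
have done1 p q : adj v p -> e v q -> p != q -> ~~ e p q -> p != y -> q != y ->
    q \in [:: a; b] -> exists p q w, [/\ adj v w, [/\ p != q & ~~ e p q], e v p /\ e v q, e w p /\ e w q &
    {in [:: p; q], forall x, x != y /\ (x \in [:: a; b] \/ adj v x)}].
  move=> vp vq pq npq py qy qab; have [w vw [wp wq]] := aux p q vp vq pq npq.
  exists p, q, w; split=> //; first by split=> //; apply: eadj.
  by move=> x; rewrite !inE => /orP[]/eqP->; split=> //; [right | left; rewrite !inE in qab].
have va := eB a aB av; have vb := eB b bB bv.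
have nba : ~~ e b a by rewrite power_adj_sym.
have [vaa|nva] := boolP (adj v a).
  by apply: (done1 a b); rewrite // !inE eqxx orbT.
have [vbb|nvb] := boolP (adj v b).
  by apply: (done1 b a); rewrite // ?inE ?eqxx // eq_sym.
have mid x : x \in B v -> x != v -> ~~ adj v x -> exists2 m, adj v m & adj m x.
  by move=> /in_ball2[->|[->|[m vm mx]]]; rewrite ?eqxx //; exists m.
have [p vp pa] := mid a aB av nva; have [q vq qb] := mid b bB bv nvb.
have pair w : adj v w -> e w a -> e w b ->
   exists p q w, [/\ adj v w, [/\ p != q & ~~ e p q], e v p /\ e v q, e w p /\ e w q &
    {in [:: p; q], forall x, x != y /\ (x \in [:: a; b] \/ adj v x)}].
  move=> vw wa wb; exists a, b, w; split=> // x.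
  by rewrite !inE => /orP[]/eqP->; split=> //; left; rewrite eqxx ?orbT.
have pb : p != b by apply: contraNneq nvb => <-.
have qa : q != a by apply: contraNneq nva => <-.
have [epb|npb] := boolP (e p b); first by apply: (pair p) => //; apply: eadj.
have [py|py] := eqVneq p y; last by apply: (done1 p b); rewrite // !inE eqxx orbT.
have [eqa|nqa] := boolP (e q a); first by apply: (pair q) => //; apply: eadj.
have qy : q != y.
  by apply: contraNneq npb => qy; rewrite py -qy; apply: eadj.
by apply: (done1 q a); rewrite // !inE eqxx.
Qed.

Definition boundary Y := [set x in Y | [exists y in ~: Y, adj x y]].

Lemma boundaryP Y x : reflect (x \in Y /\ exists2 y, y \notin Y & adj x y) (x \in boundary Y).
Proof.
rewrite !inE; apply: (iffP andP) => -[xY].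
  by case/exists_inP => y; rewrite inE => yY xy; split=> //; exists y.
by case=> y yY xy; split=> //; apply/exists_inP; exists y; rewrite ?inE.
Qed.

Lemma exit_edge Y : Y != set0 -> Y != setT ->
  exists x y, [/\ x \in Y, y \notin Y & adj x y].
Proof.
case/set0Pn => x xY YT; have [/existsP[x' x'B]|] := boolP [exists x', x' \in boundary Y].
  by have [x'Y [y yY xy]] := boundaryP _ _ x'B; exists x', y.
rewrite negb_exists => /forallP no; case/eqP: YT; apply/setP => z; rewrite inE.
have cl : closed (@adj G) (mem Y).
  apply: intro_closed; first exact: sym_connect_sym (@adj_sym G).
  move=> u v uv uY; apply/negPn/negP => vY; case/negP: (no u).
  by apply/boundaryP; split=> //; exists v.
by rewrite -(closed_connect cl (conG x z)).
Qed.

(** The vertex y outside Y has at most 4 neighbours in Y, all of them on the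
    boundary, and at most 2 neighbours in common with each boundary vertex; so it
    has a neighbour v without any neighbour in Y. *)
Lemma new_centre Y : #|boundary Y| <= 4 -> Y != set0 -> Y != setT ->
  exists x y v, [/\ x \in Y, y \notin Y, adj x y, adj y v &
    v \notin Y /\ forall z, adj v z -> z \notin Y].
Proof.
move=> b4 Y0 YT; have [x [y [xY yY xy]]] := exit_edge Y0 YT.
have bd z u : z \in Y -> u \notin Y -> adj z u -> z \in boundary Y.
  by move=> zY uY zu; apply/boundaryP; split=> //; exists u.
pose bad := boundary Y :|: \bigcup_(s in boundary Y) (N y :&: N s).
have c : #|bad| <= 12.
  apply: leq_trans (leq_card_setU _ _) _; rewrite -[12]/(4 + 8) leq_add //.
  apply: leq_trans (card_bigcup_const (k := 2) _) _; last exact: leq_mul b4 (leqnn 2).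
  move=> s /boundaryP[sY _]; apply: codegree_le2; by apply: contraNneq yY => ->.
have : 0 < #|N y :\: bad|.
  have := cardsID bad (N y); have := subset_leq_card (subsetIr (N y) bad).
  by rewrite card_N; move: c D_large; clear; lia.
case/card_gt0P => v; rewrite !inE negb_or => /andP[/andP[vb vU] yv].
have vY : v \notin Y.
  apply: contraNN vb => vY; have := bd v y vY yY; rewrite adjC yv => /(_ isT).
  by rewrite !inE.
exists x, y, v; split=> //; split=> // z vz; apply: contraNN vU => zY.
apply/bigcupP; exists z; last by rewrite !inE yv adjC.
by apply: bd zY vY _; rewrite adjC.
Qed.

(** Induction on the complement of a connected set Y with at most 4 boundary
    vertices. Near Y, but outside it, there is a configuration of two pairs, whose
    set S avoids Y and whose centre v is joined to Y outside S. The component R of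
    v in G - S contains Y. If R and S are everything, then G - S is connected
    and the colouring can be finished; otherwise their union is a larger connected
    set, and its boundary is contained in S. *)
Lemma colourable_spread Y : Y != set0 -> Y != setT -> #|boundary Y| <= 4 ->
  {in Y &, forall a b, connect (@avoid G (~: Y)) a b} -> colourable G 2 n.
Proof.
move: {2}#|~: Y| (leqnn #|~: Y|) => k; elim: k Y => [|k IH] Y.
  rewrite leqn0 cards_eq0 => /eqP YC _ YT; case/eqP: YT.
  by rewrite -(setCK Y) YC setC0.
move=> Yk Y0 YT b4 conY.
have [x [y [v [xY yY xy yv [vY vN]]]]] := new_centre b4 Y0 YT.
have vy : adj v y by rewrite adjC.
have BY z : z \in B v -> z \in Y -> z \in boundary Y.
  move=> /in_ball2[<-|[vz|[m vm mz]]] zY; first by rewrite zY in vY.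
    by have := vN z vz; rewrite zY.
  by apply/boundaryP; split=> //; exists m; rewrite ?vN // adjC.
pose X := B v :\ v :\ y :\: Y.
have XP z : z \in X -> [/\ z \in B v, z != v, z != y & z \notin Y].
  by rewrite in_setD !in_setD1 => /and4P[-> -> -> ->].
have cX : n.+1 <= #|X| + 6.
  have := ball_ge v; rewrite (cardsD1 v) ball_self // (cardsD1 y).
  rewrite -(cardsID Y (B v :\ v :\ y)).
  have : #|(B v :\ v :\ y) :&: Y| <= 4.
    apply: leq_trans b4; apply/subset_leq_card/subsetP => z.
    by rewrite in_setI !in_setD1 => /andP[/and3P[_ _ zB] zY]; apply: BY.
  rewrite -/X; case: (y \in _) => /=; clear; lia.
have [|a [b [aX bX ab nab]]] := spread (X := X).
  by rewrite (leq_trans cX) // leq_add2l.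
have [aB av ay aY] := XP a aX; have [bB bv by_ bY] := XP b bX.
have [p [q [w [vw [pq npq] [vp vq] [wp wq] pqP]]]] :=
  seen_pair aB bB av bv ay by_ ab nab.
have pqY z : z \in [:: p; q] -> z != y /\ z \notin Y.
  move=> /pqP[zy [|vz]]; last by rewrite vN.
  by rewrite !inE => /orP[]/eqP->.
have [py pY] := pqY p (mem_head _ _).
have [qy qY] : q != y /\ q \notin Y by apply: pqY; rewrite !inE eqxx orbT.
have [|a' [b' [a'X b'X ab' nab']]] := spread (X := X :\ p :\ q :\ w).
  move: cX; rewrite (cardsD1 p) (cardsD1 q (_ :\ p)) (cardsD1 w (_ :\ q)).
  by do 3!case: (_ \in _); clear; lia.
have X'P z : z \in X :\ p :\ q :\ w -> [/\ z != p, z != q, z != w & z \in X].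
  by rewrite !in_setD1 => /and4P[-> -> -> ->].
have [a'p a'q a'w {}a'X] := X'P a' a'X; have [b'p b'q b'w {}b'X] := X'P b' b'X.
have [a'B a'v a'y a'Y] := XP a' a'X; have [b'B b'v b'y b'Y] := XP b' b'X.
have cf : config 2 v w p q a' b'.
  split=> //.
  - rewrite /= !inE !negb_or pq ab' !andbT !(eq_sym p) !(eq_sym q).
    by rewrite a'p b'p a'q b'q.
  - move=> z; rewrite !inE => /or4P[]/eqP-> //.
      by rewrite powerE eq_sym a'v a'B.
    by rewrite powerE eq_sym b'v b'B.
  - rewrite !inE !negb_or !(eq_sym w) a'w b'w !andbT; apply/andP; split.
      by apply: contraTneq wp => ->; rewrite power_adj_irrefl.
    by apply: contraTneq wq => ->; rewrite power_adj_irrefl.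
pose S := [set p; q; a'; b'].
have SP z : z \in S -> [/\ z \notin Y, z != y & z \in B v].
  rewrite config_set => zS; have : z \in B v by have := cfg_v cf zS; rewrite powerE => /andP[].
  by move: zS; rewrite !inE => /or4P[]/eqP->.
have vS : v \notin S by rewrite config_set (config_v cf).
have yS : y \notin S by apply/negP => /SP[_]; rewrite eqxx.
have YS z : z \in Y -> z \notin S by move=> zY; apply/negP => /SP[]; rewrite zY.
pose R := [set z | connect (avoid S) v z].
have RS z : z \in R -> z \notin S.
  rewrite inE => /connectP[r]; case/lastP: r => [_ -> //|r u].
  by rewrite rcons_path last_rcons => /andP[_ /and3P[_ _ uS]] ->.
have Rstep u z : u \in R -> adj u z -> z \notin S -> z \in R.
  move=> uR uz zS; have uS := RS u uR; rewrite !inE in uR *.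
  by apply: connect_trans uR (connect1 _); rewrite /= uz uS.
have vR : v \in R by rewrite inE connect0.
have xR : x \in R.
  by apply: (Rstep y); rewrite ?YS // 1?adjC //; apply: (Rstep v).
have YR : Y \subset R.
  apply/subsetP => z zY; rewrite inE; apply: (@connect_trans _ _ x).
    by rewrite inE in xR.
  apply: connect_sub (conY x z xY zY) => s t /and3P[st]; rewrite !inE !negbK => sY tY.
  by apply: connect1; rewrite /= st !YS.
pose Y' := R :|: S.
have vY' : v \in Y' by rewrite in_setU vR.
have n2 : 1 < n by move: Dn D_large; clear; nia.
have [Y'T|Y'T] := eqVneq Y' setT.
  apply: (config_connected conG g2 ball_le n2 cf) => u uS.
  have : u \in Y' by rewrite Y'T inE.
  by rewrite in_setU (negbTE (uS : u \notin S)) orbF inE avoid_sym.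
apply: (IH Y') => //.
- rewrite -ltnS; apply: leq_trans Yk; apply/proper_card/properP; split.
    by rewrite setCS; apply: subset_trans YR (subsetUl _ _).
  by exists v; rewrite inE ?negbK // vY.
- by apply/set0Pn; exists v.
- have c4 : #|S| = 4.
    have := card_uniqP (cfg_uniq cf) => /= <-; apply: eq_card => z.
    exact: config_set.
  rewrite -c4; apply/subset_leq_card/subsetP => z /boundaryP[zY' [u uY' zu]].
  move: zY'; rewrite in_setU => /orP[zR|//].
  by move: uY'; rewrite in_setU negb_or => /andP[uR uS]; rewrite (Rstep z u zR zu uS) in uR.
have conv z : z \in Y' -> connect (avoid (~: Y')) v z.
  have edge s t : s \in Y' -> t \in Y' -> adj s t -> connect (avoid (~: Y')) s t.
    by move=> sY tY st; apply: connect1; rewrite /= st !in_setC sY tY.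
  have conR t : t \in R -> connect (avoid (~: Y')) v t.
    rewrite inE => /connectP[r]; elim/last_ind: r t => [|r u IHr] t /=; first by move=> _ ->.
    rewrite rcons_path last_rcons => /andP[pr lu] ->.
    have lR : last v r \in R by rewrite inE; apply/connectP; exists r.
    move: lu => /and3P[lu _ uS].
    apply: connect_trans (IHr _ pr erefl) (edge _ _ _ _ lu); rewrite in_setU ?lR //.
    by rewrite (Rstep _ _ lR lu uS).
  rewrite in_setU => /orP[/conR//|zS]; have [_ _ zB] := SP z zS.
  have zY' : z \in Y' by rewrite in_setU zS orbT.
  case/in_ball2: zB => [->|[vz|[m vm mz]]]; first exact: connect0.
    exact: edge vY' zY' vz.
  have mY' : m \in Y'.
    rewrite in_setU; have [mS|mS] := boolP (m \in S); first by rewrite orbT.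
    by rewrite (Rstep v m vR vm mS).
  exact: connect_trans (edge _ _ vY' mY' vm) (edge _ _ mY' zY' mz).
move=> s t sY tY; apply: connect_trans (conv t tY).
by rewrite avoid_sym conv.
Qed.

End NoNearClique.

Lemma colourable_square a b : a != b -> ~~ e a b -> colourable G 2 n.
Proof.
move=> ab nab.
have [/existsP[K /andP[bigK cl]]|] := boolP [exists K : {set G}, (n.+1 <= #|K| + 9) &&
    [forall x in K, forall y in K, (x != y) ==> e x y]].
  apply: (colourable_near_clique ab nab _ bigK) => x y xK yK xy.
  by move/forall_inP: cl => /(_ x xK)/forall_inP/(_ y yK)/implyP/(_ xy).
rewrite negb_exists => /forallP no.
have spread X : n.+1 <= #|X| + 9 -> exists a b, [/\ a \in X, b \in X, a != b & ~~ e a b].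
  move=> bigX; have := no X; rewrite bigX /= negb_forall_in => /exists_inP[c cX].
  rewrite negb_forall_in => /exists_inP[d dX]; rewrite negb_imply => /andP[cd ncd].
  by exists c, d.
apply: (colourable_spread spread (Y := [set a])).
- by apply/set0Pn; exists a; rewrite inE.
- by apply/eqP => /setP/(_ b); rewrite !inE eq_sym (negbTE ab).
- apply: leq_trans (_ : #|[set a]| <= 4); last by rewrite cards1.
  by apply/subset_leq_card/subsetP => z /boundaryP[].
- by move=> s t; rewrite !inE => /eqP-> /eqP->; apply: connect0.
Qed.

End Square.

(** * The theorem *)

Lemma colourable_chromatic (G : sgraph) g n : colourable G g n ->
  power_chromatic_number g G <= n.
Proof.
case=> c pc; rewrite /power_chromatic_number /chromatic_number.
case: ex_minnP => m _; apply; apply/existsP; exists [ffun x => c x].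
apply/forallP => x; apply/forallP => y; apply/implyP => xy; rewrite !ffunE.
by apply: pc; rewrite ?inE.
Qed.

(** Either a vertex has degree less than D, or one misses two neighbours in the
    power, or all balls have order M or M + 1. In the last case some distance
    exceeds g: otherwise all balls are G itself, so its order is M, which is
    odd, or there is no ambiguity and G is a Moore graph. *)
Lemma colourable_power (G : sgraph) (g D n : nat) :
  1 < g -> is_connected G -> max_degree G = D -> 2 < D -> odd D ->
  (g = 2 -> 1000 <= D) -> ~ is_moore_graph G D g ->
  moore_bound D g = n.+1 -> colourable G g n.
Proof.
move=> g2 [G0 conG] maxD D2 oD bigD notM Mn.
have degD (x : G) : degree x <= D by rewrite -maxD; apply: leq_bigmax.
have ball_le (x : G) : #|ball g x| <= n.+2.
  by rewrite -Mn; apply: card_ball_le (ltnW g2).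
have [/existsP[x lx]|] := boolP [exists x : G, degree x < D].
  have [z dz] := eq_bigmax (@degree G) G0.
  have {}dz : degree z = D by rewrite -maxD /max_degree dz.
  have [w xw] : exists w, adj x w.
    case d : (dist x z) => [|k]; last by have [w] := dist_next conG d; exists w.
    by move/eqP: d; rewrite dist_eq0 // => /eqP xz; rewrite xz dz ltnn in lx.
  apply: (colourable_low conG g2 ball_le xw).
    by rewrite -ltnS -Mn; apply: card_ball_low.
  by rewrite -Mn; apply: card_ball_low_nbr lx; rewrite // adjC.
rewrite negb_exists => /forallP geD.
have reg : regular G D by move=> x; apply/eqP; rewrite eqn_leq degD leqNgt geD.
have [/existsP[v bv]|] := boolP [exists v : G, #|ball g v| <= n].
  exact: (colourable_deficit2 conG g2 D2 reg Mn bv).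
rewrite negb_exists => /forallP ge.
have ball_ge (x : G) : n.+1 <= #|ball g x| by rewrite ltnNge ge.
have complete_moore : (forall x y : G, dist x y <= g) -> False.
  move=> near; have full (v : G) : ball g v = setT by apply/setP => y; rewrite !inE near.
  apply: notM; apply: (unambiguous_is_moore conG g2 D2 reg) => // v av.
  have := regular_odd_order reg oD; rewrite -cardsT -(full v).
  by rewrite (amb_card conG g2 D2 reg Mn ball_ge av) -Mn odd_moore_bound // ltnW.
have [x [y xy]] : exists x y : G, g < dist x y.
  have [/existsP[x /existsP[y xy]]|no] := boolP [exists x : G, exists y : G, g < dist x y].
    by exists x, y.
  case: complete_moore => x y; rewrite leqNgt; apply: contraNN no => xy.
  by apply/existsP; exists x; apply/existsP; exists y.
move: (g2); rewrite leq_eqVlt => /orP[/eqP gE|g3].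
  subst g; have nxy : x != y by apply: contraTneq xy => ->; rewrite dist_xx.
  apply: (colourable_square conG _ reg _ ball_ge nxy).
  - exact: bigD.
  - by rewrite -moore_bound2.
  - by rewrite power_adjE // [_ <= 2]leqNgt xy andbF.
have [/existsP[v av]|no] := boolP [exists v : G, #|ball g v| <= n.+1].
  by apply: (colourable_ambiguous_ge3 conG g2 D2 reg Mn ball_ge g3 oD (v := v)); apply/(ambP conG g2 D2 reg Mn).
apply: (colourable_unambiguous_ge3 conG g2 D2 reg Mn _ g3 xy) => v /(ambP conG g2 D2 reg Mn) av.
by case/existsP: no; exists v.
Qed.

Import Order.TTheory GRing.Theory Num.Theory.
Local Open Scope ring_scope.

Lemma powR_half_ge (R : realType) : 1000 <= (10 ^+ 14 + 1) `^ (1 / 2%:R) :> R.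
Proof.
have h : (0 <= 10 ^+ 14 + 1 :> R) by rewrite addr_ge0 ?exprn_ge0 ?ler0n ?ler01.
rewrite div1r powR12_sqrt // -[leLHS]ger0_norm ?ler0n // -sqrtr_sqr ler_wsqrtr //.
apply: (@le_trans _ _ (10 ^+ 14)); last by rewrite lerDl.
have -> : 1000 = 10 ^+ 3 :> R by rewrite -natrX.
by rewrite -exprM ler_weXn2l // ler1n.
Qed.

Theorem theorem2p10 (R : realType) (g : nat) (hg : (2 <= g)%N) :
  let has_property (D0 : R) :=
    forall (G : sgraph) (D : nat),
      is_connected G -> max_degree G = D -> (3 <= D)%N ->
      odd D -> D0 <= D%:R ->
      ~ is_moore_graph G D g ->
      (power_chromatic_number g G <= moore_bound D g - 1)%N in
  (exists D0 : R, has_property D0) /\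
  has_property ((10 ^+ 14 + 1) `^ (1 / g%:R) + 1).
Proof.
move=> has_property.
suff prop : has_property ((10 ^+ 14 + 1) `^ (1 / g%:R) + 1).
  by split=> //; exists ((10 ^+ 14 + 1) `^ (1 / g%:R) + 1).
move=> G D conG maxD D3 oD D0 notM; apply: colourable_chromatic.
have M0 : (0 < moore_bound D g)%N.
  by rewrite moore_boundE // muln_gt0 (ltn_trans _ D3) //= geo_gt0 // ltnW.
apply: colourable_power hg conG maxD D3 oD _ notM _; last first.
  by rewrite subn1 prednK.
move=> gE; subst g; rewrite -(@ler_nat R); apply: le_trans D0.
by apply: le_trans (powR_half_ge R) _; rewrite lerDl.
Qed.
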